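(* (i) For each integer $n\geq 6$, the least positive integer $m$ such that the integers $4k(4k-1)$ $(k=1,\ldots,n)$ are pairwise distinct modulo $m$ is the least prime $p\equiv 1\pmod 4$ with $p\geq (8n-1)/3$; and the least positive integer $m$ such that the integers $4k(4k+1)$ $(k=1,\ldots,n)$ are pairwise distinct modulo $m$ is the least prime $p\equiv -1\pmod 4$ with $p\geq (8n+1)/3$. (ii) Let $C_1=8$, $C_2=10$, $C_{-1}=15$ and $C_{-2}=5$. For any $r\in\{1,-1,2,-2\}$ and any integer $n\geq C_r$, the least positive integer $m$ such that the integers $10k(5k-r)$ $(k=1,\ldots,n)$ are pairwise distinct modulo $m$ is the least prime $p\equiv r\pmod 5$ with $p\geq (10n-r)/4$. *)

(* Defs.v *)
From mathcomp Require Import all_boot all_order all_algebra.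

Set Implicit Arguments.
Unset Strict Implicit.
Unset Printing Implicit Defensive.

Import Order.TTheory GRing.Theory Num.Theory.
Local Open Scope ring_scope.

Definition is_least (P : nat -> Prop) (m : nat) : Prop :=
  P m /\ forall m' : nat, P m' -> (m <= m')%N.

Definition pairwise_distinct_mod (f : nat -> int) (n m : nat) : Prop :=
  forall i j : nat, (1 <= i <= n)%N -> (1 <= j <= n)%N -> i <> j ->
    (f i <> f j %[mod m%:Z])%Z.

Definition is_least_modulus (f : nat -> int) (n m : nat) : Prop :=
  is_least (fun m' => (0 < m')%N /\ pairwise_distinct_mod f n m') m.

Definition is_least_prime (a : int) (d : nat) (b : rat) (p : nat) : Prop :=
  is_least (fun q => [/\ prime q, (q%:Z = a %[mod d%:Z])%Z & b <= q%:R]) p.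

(* The constants C_r; the value at any other r is a dummy. *)
Definition Cbound (r : int) : nat :=
  if r == 1 then 8
  else if r == 2 then 10
  else if r == -1 then 15
  else if r == -2 then 5
  else 0.

(* Main.v *)
(** With f k = al k (d k - r) one has f j - f i = al (j - i) (d (i + j) - r), so m is
    inadmissible iff it divides al (j - i) (d (i + j) - r) for some 1 <= i < j <= n.
    If the least prime p of the required class divided this, then d s - r = t p with
    s = i + j < 2n, but t = -1 mod d gives t >= d - 1 and s >= 2n.  Conversely,
    every m < p is hit: by d s - r = t m with a small t when m is prime or in a wrong
    class, and by j - i = a for a suitable factorisation m = a b when m is composite.
    This last step needs p to be at most about 4n, resp. 10n/3, that is, a prime of the
    class in every interval (x, 3x/2] (mod 4), resp. (x, 4x/3] (mod 5), for x >= 140; it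
    also needs n >= 60, and smaller n are left to a computation.

    Such primes come from Chebyshev's method.  With T(x; a) the sum of log n over n <= x,
    n = a mod q, a combination of the T(x/k; a) with real coefficients t_k(a) equals the
    sum of W(p^j r, x / p^j) log p over the prime powers p^j <= x, where
    W(b, y) is the sum of the t_k(m b) over all k and all m <= y/k.  The coefficients are
    chosen such that the sum is at least c x - O(log x) with c > 0, while W(b, y) is at most
    1 if b = 1 mod q and u <= y < v, plus s if y >= Y.  The second part contributes at
    most a multiple of theta(x/Y), theta(z) <= z log 4, and what is left shows that there
    is a prime p = 1/r mod q in (x/v, x/u].  Small x are covered by explicit chains of
    primes. *)
Require Import Defs.
From mathcomp Require Import all_boot all_order all_algebra.
From mathcomp Require Import ring lra zify ssrZ Rstruct.
From Stdlib Require NArith ZArith Rpower.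

Set Implicit Arguments.
Unset Strict Implicit.
Unset Printing Implicit Defensive.

Import Order.TTheory GRing.Theory Num.Theory.
Local Open Scope ring_scope.

Declare Scope binZ_scope.
Delimit Scope binZ_scope with BZ.
Number Notation BinNums.Z BinIntDef.Z.of_num_int BinIntDef.Z.to_num_int : binZ_scope.
Declare Scope binN_scope.
Delimit Scope binN_scope with BN.
Number Notation BinNums.N BinNatDef.N.of_num_uint BinNatDef.N.to_num_uint : binN_scope.

(** * Factorials, middle binomial coefficients and residue classes *)

Lemma prime_dvd_fact p m : prime p -> (p %| m`!)%N = (p <= m)%N.
Proof.
move=> pp; have p0 := prime_gt0 pp.
apply/idP/idP => [|pm]; last by apply: dvdn_fact; rewrite p0.
elim: m => [|m IH]; first by rewrite fact0 dvdn1 => /eqP p1; rewrite p1 in pp.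
rewrite factS Euclid_dvdM // => /orP[/(dvdn_leq (ltn0Sn m))//|/IH].
exact: leqW.
Qed.

(** Two equal coefficients occur in the expansion of (1 + 1)^(2m + 1), so each is at most half of
    2^(2m + 1). *)
Lemma bin_odd_middle_le m : ('C(m.*2.+1, m) <= 4 ^ m)%N.
Proof.
have h : ('C(m.*2.+1, m) + 'C(m.*2.+1, m.+1) <= 2 ^ m.*2.+1)%N.
  have -> : (2 ^ m.*2.+1 = \sum_(i < m.*2.+2) 'C(m.*2.+1, i))%N.
    rewrite -[2%N]/(1 + 1)%N expnDn; apply: eq_bigr => i _.
    by rewrite !exp1n !muln1.
  have hm : (m < m.*2.+2)%N by lia.
  have hm1 : (m.+1 < m.*2.+2)%N by lia.
  rewrite (bigD1 (Ordinal hm)) //= (bigD1 (Ordinal hm1)) /=; first by lia.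
  by rewrite -val_eqE /=; lia.
have hm : (m.*2.+1 - m = m.+1)%N by lia.
have hm2 : (m <= m.*2.+1)%N by lia.
have := bin_sub hm2; rewrite hm => e; rewrite e addnn -mul2n expnS in h.
by move: h; rewrite leq_pmul2l // -mul2n expnM.
Qed.

Lemma residue_inj q k N n m : coprime q k -> (N < n <= N + q)%N -> (N < m <= N + q)%N ->
  (n * k == m * k %[mod q])%N -> n = m.
Proof.
move=> qk; wlog nm : n m / (n <= m)%N.
  by move=> H hn hm; case/orP: (leq_total n m) => h; [|rewrite eq_sym => e];
    [|apply/esym]; apply: H.
move=> hn hm; rewrite eq_sym eqn_mod_dvd ?leq_mul2r ?nm ?orbT //.
rewrite -mulnBl Gauss_dvdl // => h.
have [|mn] := posnP (m - n)%N; first by lia.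
by have := dvdn_leq mn h; lia.
Qed.

(** Multiplication by a unit is injective on q consecutive integers modulo q, hence bijective onto
    the residues. *)
Lemma exists_residue q k a N : (0 < q)%N -> coprime q k ->
  exists2 n, (N < n <= N + q)%N & (n * k == a %[mod q])%N.
Proof.
move=> q0 qk; pose h (i : 'I_q) : 'I_q := Ordinal (ltn_pmod ((N.+1 + i) * k) q0).
have hinj : injective h.
  move=> i j /(congr1 val) /= /eqP e; apply: val_inj => /=.
  have := @residue_inj q k N (N.+1 + i) (N.+1 + j) qk _ _ e.
  by have := ltn_ord i; have := ltn_ord j; lia.
have [g _ gh] := injF_bij hinj.
pose i0 := g (Ordinal (ltn_pmod a q0)); exists (N.+1 + i0)%N.
  by have := ltn_ord i0; lia.
by have := gh (Ordinal (ltn_pmod a q0)) => /(congr1 val) /= /eqP.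
Qed.

(** * Inequalities for a logarithm known only through [lnM] and [ln_subr1] *)

Section Chebyshev.
Variables (R : realFieldType) (ln : R -> R).
Hypothesis lnM : forall x y : R, 0 < x -> 0 < y -> ln (x * y) = ln x + ln y.
Hypothesis ln_subr1 : forall x : R, 0 < x -> ln x <= x - 1.

Lemma ln1 : ln 1 = 0.
Proof. by have := lnM ltr01 ltr01; rewrite mulr1; lra. Qed.

Lemma lnV x : 0 < x -> ln x^-1 = - ln x.
Proof.
move=> x0; have xV0 : 0 < x^-1 by rewrite invr_gt0.
by have := lnM x0 xV0; rewrite divff ?gt_eqF // ln1; lra.
Qed.

Lemma ln_ge0 x : 1 <= x -> 0 <= ln x.
Proof.
move=> x1; have x0 : 0 < x by lra.
have := @ln_subr1 x^-1; rewrite invr_gt0 lnV // => /(_ x0) h.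
have : x^-1 <= 1 by rewrite invf_le1.
lra.
Qed.

Lemma ler_ln x y : 0 < x -> x <= y -> ln x <= ln y.
Proof.
move=> x0 xy; have -> : y = x * (y / x) by field; rewrite gt_eqF.
have yx1 : 1 <= y / x by rewrite ler_pdivlMr // mul1r.
by rewrite lnM ?(lt_le_trans ltr01 yx1) //; have := ln_ge0 yx1; lra.
Qed.

Lemma lnX x n : 0 < x -> ln (x ^+ n) = ln x *+ n.
Proof.
move=> x0; elim: n => [|n IH]; first by rewrite expr0 ln1 mulr0n.
by rewrite exprS lnM ?exprn_gt0// IH mulrS.
Qed.

(** This is [ln_subr1] at 1/2. It later allows constants to be absorbed into multiples of ln 2. *)
Lemma ln2_ge : 1 <= 2 * ln 2.
Proof.
have h0 : 0 < (2^-1 : R) by rewrite invr_gt0 ltr0n.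
by have := ln_subr1 h0; rewrite lnV ?ltr0n //; lra.
Qed.

Lemma ln_nat_ge0 n : (0 < n)%N -> 0 <= ln n%:R.
Proof. by move=> n0; rewrite ln_ge0 // ler1n. Qed.

Lemma ler_ln_nat m n : (0 < m)%N -> (m <= n)%N -> ln m%:R <= ln n%:R.
Proof. by move=> m0 mn; apply: ler_ln; rewrite ?ltr0n ?ler_nat. Qed.

Lemma ln_prod (I : Type) (s : seq I) (P : pred I) (F : I -> nat) :
  (forall i, P i -> 0 < F i)%N ->
  ln ((\prod_(i <- s | P i) F i)%:R) = \sum_(i <- s | P i) ln (F i)%:R.
Proof.
move=> F0; elim: s => [|i s IH]; first by rewrite !big_nil ln1.
rewrite !big_cons; case: ifP => // Pi; rewrite natrM lnM ?IH// ltr0n ?F0//.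
by apply: prodn_cond_gt0.
Qed.

Lemma sum_leq_nat x L : (\sum_(1 <= j < x.+1) (j <= L) = minn x L)%N.
Proof.
elim: x => [|x IH]; first by rewrite big_geq // min0n.
by rewrite big_nat_recr //= IH; lia.
Qed.

(** The inner sum counts the j with p^j dividing n, so this is the factorisation of n in logarithmic
    form. Both ranges run up to x to be the same for all n <= x, which permits exchanging sums. *)
Lemma ln_prime_powers x n : (0 < n <= x)%N ->
  ln n%:R = \sum_(0 <= p < x.+1 | prime p) \sum_(1 <= j < x.+1)
    (p ^ j %| n)%:R * ln p%:R.
Proof.
case/andP=> n0 nx.
have {1}-> : n = (\prod_(0 <= p < x.+1 | prime p) p ^ logn p n)%N.
  rewrite -{1}(partnT n0) /partn (big_cat_nat _ (n := n.+1) (p := x.+1)) //=.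
  rewrite [X in _ = (_ * X)%N]big_nat_cond [X in _ = (_ * X)%N]big1 ?muln1; last first.
    move=> p /andP[/andP[np _] pp]; rewrite (eqP (_ : logn p n == 0%N)) //.
    by rewrite -leqn0 leqNgt logn_gt0 mem_primes pp n0 /= gtnNdvd.
  rewrite [RHS]big_mkcond; apply: eq_big => // p _.
  by case: ifP => // pp; rewrite lognE pp.
rewrite ln_prod => [|p pp]; last by rewrite expn_gt0 prime_gt0.
apply: eq_bigr => p pp; rewrite natrX lnX ?ltr0n ?prime_gt0//.
rewrite -mulr_suml -natr_sum mulr_natl; congr (_ *+ _).
have /minn_idPr <- : (logn p n <= x)%N by rewrite (leq_trans _ nx) // ltnW // ltn_logl.
rewrite -sum_leq_nat; apply: eq_bigr => j _; rewrite pfactor_dvdn ?pp ?n0 //.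
Qed.

Lemma sum_multiples (V : nmodType) (g : nat -> V) N d : (0 < d)%N ->
  \sum_(1 <= n < N.+1 | (d %| n)%N) g n = \sum_(1 <= m < (N %/ d)%N.+1) g (m * d)%N.
Proof.
move=> d0; elim: N => [|N IH]; first by rewrite div0n !big_geq.
rewrite big_mkcond big_nat_recr //= -big_mkcond IH divnS //.
case: ifP => [dN|_]; last by rewrite addr0 add0n.
rewrite add1n [RHS]big_nat_recr //=; congr (_ + g _).
by rewrite -{1}(divnK dN) divnS // dN add1n.
Qed.

Lemma sum_ln_prime_powers x N (g : nat -> R) : (N <= x)%N ->
  \sum_(1 <= n < N.+1) g n * ln n%:R =
  \sum_(0 <= p < x.+1 | prime p) \sum_(1 <= j < x.+1)
     ln p%:R * \sum_(1 <= m < (N %/ p ^ j)%N.+1) g (m * p ^ j)%N.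
Proof.
move=> Nx.
transitivity (\sum_(1 <= n < N.+1) \sum_(0 <= p < x.+1 | prime p)
    \sum_(1 <= j < x.+1) ((p ^ j %| n)%:R * ln p%:R * g n)).
  rewrite big_nat_cond [RHS]big_nat_cond; apply: eq_bigr => n /andP[/andP[n1 nN] _].
  rewrite (@ln_prime_powers x n) ?n1 ?(leq_trans _ Nx) // mulr_sumr.
  apply: eq_bigr => p _; rewrite mulr_sumr.
  by apply: eq_bigr => j _; rewrite mulrC.
rewrite exchange_big; apply: eq_bigr => p pp.
rewrite exchange_big; apply: eq_bigr => j _.
rewrite -sum_multiples ?expn_gt0 ?prime_gt0 // mulr_sumr [RHS]big_mkcond.
by apply: eq_bigr => n _; case: ifP => _; rewrite ?mul1r ?mul0r.
Qed.


Lemma ler_lnB x y : 0 < x -> 0 < y -> x * (ln y - ln x) <= y - x.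
Proof.
move=> x0 y0; have yx0 : 0 < y / x by rewrite divr_gt0.
have := ln_subr1 yx0; rewrite lnM ?invr_gt0 // lnV // => h.
have := ler_wpM2l (ltW x0) h.
by rewrite [X in _ <= X](_ : _ = y - x) //; field; rewrite gt_eqF.
Qed.

(** The antiderivative of the logarithm, which is the main term of log x!. *)
Definition stirling (x : R) := x * ln x - x.

Lemma stirling_incr x y : 0 < x -> x <= y ->
  ln x * (y - x) <= stirling y - stirling x <= ln y * (y - x).
Proof.
move=> x0 xy; have y0 := lt_le_trans x0 xy.
have h1 := ler_lnB x0 y0; have h2 := ler_lnB y0 x0.
by rewrite /stirling; apply/andP; split; lra.
Qed.

(** * Sums of logarithms over a residue class *)

Section Residue.
Variables (q r : nat).
Hypotheses (q0 : (0 < q)%N) (qr : coprime q r).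

Lemma residue_block a N : exists2 n0, (N < n0 <= N + q)%N &
  forall f : nat -> R,
    \sum_(N.+1 <= n < (N + q).+1 | (n * r == a %[mod q])%N) f n = f n0.
Proof.
have [n0 hn0 e0] := exists_residue a N q0 qr; exists n0 => // f.
rewrite big_mkcond /= (bigD1_seq n0) ?iota_uniq //=; last by rewrite mem_index_iota; lia.
rewrite e0 big_seq_cond big1 ?addr0 // => n /andP[]; rewrite mem_index_iota => hn ne.
case: ifP => // e; case/eqP: ne.
by apply: (@residue_inj q r N) => //; rewrite ?(eqP e0) //; lia.
Qed.

(** This is T(N; a / r): all integers of the class enter, not only the primes as in [theta]. *)
Definition theta_res a N : R := \sum_(1 <= n < N.+1 | (n * r == a %[mod q])%N) ln n%:R.

Lemma theta_res_addq a N : exists2 n0, (N < n0 <= N + q)%N &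
  theta_res a (N + q) = theta_res a N + ln n0%:R.
Proof.
have [n0 hn0 h] := residue_block a N; exists n0 => //.
by rewrite -(h (fun n => ln n%:R)) /theta_res (big_cat_nat _ (n := N.+1)) //= ltnS leq_addr.
Qed.

(** Induction in steps of q. A block of q integers contains one n0 of the class, with ln n0 <= ln (M
    + q), whereas [stirling] grows by at least q ln M. The differences telescope to q ln N. *)
Lemma theta_res_le a N : (0 < N)%N ->
  q%:R * theta_res a N <= stirling N%:R + q%:R * ln N%:R + (q ^ 3).+1%:R.
Proof.
have [m] := ubnP N; elim: m N => // m IH N /ltnSE Nm N0.
have lnN0 := ln_nat_ge0 N0.
have [Nq|qN] := leqP N q.
  (* For N <= q there are at most q terms, each at most q, and [stirling] is at least -1; this gives
     the constant q^3 + 1. *)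
  have hT : theta_res a N <= (q ^ 2)%:R.
    apply: (@le_trans _ _ (\sum_(1 <= n < N.+1) q%:R)); last first.
      rewrite sumr_const_nat subn1 /= -[q%:R *+ N]mulr_natr -natrM ler_nat -mulnn.
      by rewrite leq_mul2l Nq orbT.
    rewrite /theta_res big_mkcond !big_nat; apply: ler_sum => n /andP[n1 nN].
    have n0' : 0 < n%:R :> R by rewrite ltr0n.
    have := ln_subr1 n0'; have : n%:R <= q%:R :> R by rewrite ler_nat; lia.
    have := ler0n R q.
    case: ifP => _; lra.
  have hG : -1 <= stirling N%:R.
    have := @stirling_incr 1 N%:R ltr01; rewrite ler1n => /(_ N0) /andP[+ _].
    by rewrite /stirling ln1; lra.
  have := ler_wpM2l (ler0n R q) hT; rewrite -natrM -expnS => h.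
  have := mulr_ge0 (ler0n R q) lnN0.
  rewrite -natr1; lra.
have -> : N = (N - q + q)%N by lia.
set M := (N - q)%N; have M0 : (0 < M)%N by rewrite subn_gt0.
have Mm : (M < m)%N by lia.
have {}IH := IH M Mm M0.
have [n0 /andP[hn1 hn0] ->] := theta_res_addq a M; rewrite mulrDr.
have M0' : 0 < M%:R :> R by rewrite ltr0n.
have hn : ln n0%:R <= ln (M + q)%:R.
  by apply: ler_ln_nat => //; lia.
have := ler_wpM2l (ler0n R q) hn.
have hMq : M%:R <= (M + q)%:R :> R by rewrite ler_nat leq_addr.
have := stirling_incr M0' hMq; rewrite [(M + q)%:R - _](_ : _ = q%:R); last by rewrite natrD; ring.
by case/andP=> h _; lra.
Qed.

(** The same induction with the bounds reversed: ln n0 >= ln M, and [stirling] grows by at most q ln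
    (M + q). *)
Lemma theta_res_ge a N : (0 < N)%N ->
  stirling N%:R - q%:R * ln N%:R <= q%:R * theta_res a N.
Proof.
have [m] := ubnP N; elim: m N => // m IH N /ltnSE Nm N0.
have lnN0 := ln_nat_ge0 N0.
have [Nq|qN] := leqP N q.
  have : 0 <= theta_res a N.
    rewrite /theta_res big_mkcond big_nat; apply: sumr_ge0 => n /andP[n1 _].
    by case: ifP => // _; apply: ln_nat_ge0.
  move=> /(mulr_ge0 (ler0n R q)); have : N%:R <= q%:R :> R by rewrite ler_nat.
  move=> /(ler_wpM2r lnN0); have := ler0n R N; rewrite /stirling; lra.
have -> : N = (N - q + q)%N by lia.
set M := (N - q)%N; have M0 : (0 < M)%N by rewrite subn_gt0.
have Mm : (M < m)%N by lia.
have {}IH := IH M Mm M0.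
have [n0 /andP[hn1 hn0] ->] := theta_res_addq a M; rewrite mulrDr.
have M0' : 0 < M%:R :> R by rewrite ltr0n.
have hn : ln M%:R <= ln n0%:R by apply: ler_ln_nat => //; lia.
have := ler_wpM2l (ler0n R q) hn.
have hMq : M%:R <= (M + q)%:R :> R by rewrite ler_nat leq_addr.
have := stirling_incr M0' hMq; rewrite [(M + q)%:R - _](_ : _ = q%:R); last by rewrite natrD; ring.
by case/andP=> _ h; lra.
Qed.

End Residue.

(** * Chebyshev's upper bound for theta and the contribution of higher prime powers *)

Definition theta N : R := \sum_(0 <= p < N.+1 | prime p) ln p%:R.

(** Every prime p with m + 2 <= p <= 2m + 1 divides the binomial coefficient, because it divides (2m
    + 1)! but neither m! nor (m + 1)!. *)
Lemma theta_odd_step m : theta m.*2.+1 <= theta m.+1 + ln 'C(m.*2.+1, m)%:R.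
Proof.
rewrite /theta (big_cat_nat _ (n := m.+2)) //=; last by lia.
rewrite lerD2l; set C := 'C(_, _).
have C0 : (0 < C)%N by rewrite bin_gt0; lia.
rewrite (@ln_prime_powers (C + m.*2.+1) C) ?C0 ?leq_addr //.
have hterm p j : prime p -> 0 <= (p ^ j %| C)%N%:R * ln p%:R :> R.
  by move=> pp; rewrite mulr_ge0 // ln_nat_ge0 ?prime_gt0.
rewrite [leRHS](big_cat_nat _ (n := m.+2)) //=; last by lia.
rewrite -[leLHS]add0r lerD //.
  by apply: sumr_ge0 => p pp; apply: sumr_ge0 => j _; apply: hterm.
rewrite [leRHS](big_cat_nat _ (n := m.*2.+2)) //=; [|by lia|by lia].
rewrite -[leLHS]addr0 lerD //; last first.
  by apply: sumr_ge0 => p pp; apply: sumr_ge0 => j _; apply: hterm.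
rewrite big_nat_cond [leRHS]big_nat_cond; apply: ler_sum => p /andP[hp pp].
rewrite (big_ltn (n := (C + m.*2.+1).+1)) /=; last by lia.
rewrite expn1 (_ : (p %| C)%N) ?mul1r; last first.
  have : (p %| m.*2.+1`!)%N by rewrite prime_dvd_fact //; lia.
  rewrite -(@bin_fact m.*2.+1 m); last by lia.
  rewrite !Euclid_dvdM // !prime_dvd_fact // -/C => /orP[//|]; lia.
by rewrite lerDl; apply: sumr_ge0 => j _; apply: hterm.
Qed.

(** Strong induction: an odd N = 2k + 1 reduces to k + 1 at the cost of ln 4^k, and an even N > 2 is
    not prime and reduces to N - 1. *)
Lemma theta_le N : theta N <= (2 * N)%:R * ln 2.
Proof.
have ln20 : 0 <= ln 2 by apply: ln_ge0; rewrite ler1n.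
have [m] := ubnP N; elim: m N => // m IH N /ltnSE Nm.
have [N2|N2] := leqP N 2.
  move: N2; case: N Nm => [|[|[|//]]] _ _.
  - by rewrite /theta big_mkcond big_nat1 /= muln0 mul0r.
  - by rewrite /theta big_mkcond !big_nat_recr //= big_geq // !addr0 mulr_ge0.
  rewrite /theta big_mkcond !big_nat_recr //= big_geq // !add0r.
  by rewrite ler_peMl // ler1n.
have [oN|eN] := boolP (odd N).
  have eN : N = (N./2).*2.+1 by lia.
  move: Nm N2; rewrite eN; set k := N./2 => Nm N2.
  apply: (le_trans (theta_odd_step k)).
  have hk := IH k.+1 ltac:(lia).
  have hC : ln 'C(k.*2.+1, k)%:R <= (2 * k)%:R * ln 2.
    apply: (@le_trans _ _ (ln (2 ^ (2 * k))%N%:R)).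
      by apply: ler_ln_nat; rewrite ?bin_gt0 ?expnM ?bin_odd_middle_le //; lia.
    by rewrite natrX lnX ?ltr0n // mulr_natl.
  apply: le_trans (lerD hk hC) _.
  by rewrite -mulrDl ler_wpM2r // -natrD ler_nat; lia.
have -> : theta N = theta N.-1.
  rewrite /theta prednK; last by lia.
  rewrite big_mkcond big_nat_recr //= -big_mkcond ifF ?addr0 //.
  apply/negP => pN; case/even_prime: pN => [|oN]; first by lia.
  by rewrite oN in eN.
apply: (le_trans (IH _ _)); first by lia.
by rewrite ler_wpM2r // ler_nat; lia.
Qed.

Lemma sum_prime_powers_le p x z : prime p -> (0 < z <= x)%N ->
  \sum_(1 <= j < x.+1) (p ^ j <= z)%:R * ln p%:R <= ln z%:R.
Proof.
move=> pp /andP[z0 zx]; have p1 := prime_gt1 pp.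
rewrite -mulr_suml -natr_sum.
rewrite (eq_bigr (fun j => (j <= trunc_log p z)%N : nat)) => [|j _].
  rewrite sum_leq_nat (minn_idPr _); last first.
    apply: leq_trans zx; rewrite -(leq_exp2l _ _ p1).
    by apply: leq_trans (trunc_logP p1 z0) _; apply/ltnW/ltn_expl.
  rewrite mulr_natl -lnX ?ltr0n ?prime_gt0 // -natrX.
  by apply: ler_ln_nat; rewrite ?expn_gt0 ?prime_gt0 // trunc_logP.
congr nat_of_bool; apply/idP/idP; first exact: trunc_log_max.
by move=> h; apply: leq_trans (trunc_logP p1 z0); rewrite leq_exp2l.
Qed.

(** A square p^2 <= z forces p < M, and the powers of one prime contribute at most ln z together. *)
Lemma sum_higher_prime_powers_le M x z : (0 < z <= x)%N -> (z < M ^ 2)%N ->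
  \sum_(0 <= p < x.+1 | prime p) \sum_(2 <= j < x.+1) (p ^ j <= z)%:R * ln p%:R
  <= M%:R * ln z%:R.
Proof.
move=> zx zM; case/andP: (zx) => z0 _; have lnz0 := ln_nat_ge0 z0.
have h p : prime p -> \sum_(2 <= j < x.+1) (p ^ j <= z)%:R * ln p%:R <=
    (p < M)%N%:R * ln z%:R.
  move=> pp; have lnp0 := ln_nat_ge0 (prime_gt0 pp).
  have [pM|Mp] := ltnP p M; last first.
    rewrite mul0r big_nat big1 // => j /andP[j2 _].
    rewrite (_ : (p ^ j <= z)%N = false) ?mul0r //; apply/negbTE; rewrite -ltnNge.
    apply: (leq_trans zM); apply: (@leq_trans (p ^ 2)%N); first by rewrite leq_exp2r.
    by rewrite (leq_exp2l _ _ (prime_gt1 pp)).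
  rewrite mul1r; apply: le_trans (sum_prime_powers_le pp zx).
  by rewrite [leRHS]big_ltn ?lerDr ?mulr_ge0 // ltnS; case/andP: zx => /leq_trans h /h.
apply: (le_trans (ler_sum _ h)); rewrite -mulr_suml ler_wpM2r // -natr_sum ler_nat.
rewrite big_mkcond /=.
apply: (@leq_trans (\sum_(0 <= p < x.+1) (p < M))); first by apply: leq_sum => p _; case: ifP.
suff -> : (\sum_(0 <= p < x.+1) (p < M) = minn x.+1 M)%N by rewrite geq_minr.
elim: x.+1 => [|k IH]; first by rewrite big_geq // min0n.
by rewrite big_nat_recr //= IH; lia.
Qed.

(** Rounding x / k down changes [stirling] by at most ln x, which turns the factor q of the two
    preceding bounds into q + 1. *)
Lemma theta_res_div k x a q r : (0 < k <= x)%N -> (0 < q)%N -> coprime q r ->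
  `|q%:R * theta_res q r a (x %/ k) - stirling (x%:R / k%:R)|
    <= q.+1%:R * ln x%:R + (q ^ 3).+1%:R.
Proof.
case/andP=> k0 kx q0 qr.
have k0' : 0 < k%:R :> R by rewrite ltr0n.
have x0 : (0 < x)%N by apply: leq_trans kx.
have N0 : (0 < x %/ k)%N by rewrite divn_gt0.
have N0' : 0 < (x %/ k)%:R :> R by rewrite ltr0n.
have hN : (x %/ k)%:R <= x%:R / k%:R :> R.
  by rewrite ler_pdivlMr // -natrM ler_nat leq_trunc_div.
have hN1 : x%:R / k%:R - (x %/ k)%:R <= 1 :> R.
  by rewrite lerBlDl ler_pdivrMr // natr1 -natrM ler_nat ltnW // ltn_ceil.
have lnX : ln (x%:R / k%:R) <= ln x%:R.
  apply: ler_ln; first exact: lt_le_trans hN.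
  by rewrite ler_pdivrMr // ler_peMr // ler1n.
have lnX0 : 0 <= ln (x%:R / k%:R).
  by apply: ln_ge0; rewrite ler_pdivlMr // mul1r ler_nat.
have lnN : ln (x %/ k)%:R <= ln x%:R by apply: ler_ln_nat => //; rewrite leq_div.
have lnN0 := ln_nat_ge0 N0.
have /andP[h1 h2] := stirling_incr N0' hN.
have h3 := theta_res_le q0 qr a N0.
have h4 := theta_res_ge q0 qr a N0.
have d0 : 0 <= x%:R / k%:R - (x %/ k)%:R :> R by rewrite subr_ge0.
have h5 := mulr_ge0 lnN0 d0.
have h6 := ler_wpM2l lnX0 hN1.
have h7 := ler_wpM2l (ler0n R q) lnN.
have h8 := ler0n R (q ^ 3).+1.
rewrite -natr1 ler_norml; apply/andP; split; lra.
Qed.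

(** * Linear combinations of the class sums: lower bound, upper bound and the resulting prime *)

Section Certificate.
Variables (q r : nat) (K : seq (nat * seq R)).
Hypotheses (q0 : (0 < q)%N) (qr : coprime q r).

Definition weight b y : R :=
  \sum_(e <- K) \sum_(1 <= m < (y %/ e.1).+1) e.2`_((m * b) %% q).

Definition log_sum x : R :=
  \sum_(e <- K) \sum_(1 <= n < (x %/ e.1).+1) e.2`_((n * r) %% q) * ln n%:R.

(** Expand ln n over the prime powers dividing n, write n = m p^j and exchange the sums. The
    coefficients met by ln p form a weight at x / p^j because iterated floor divisions commute. *)
Lemma log_sum_weight x : log_sum x =
  \sum_(0 <= p < x.+1 | prime p) \sum_(1 <= j < x.+1)
     ln p%:R * weight (p ^ j * r) (x %/ p ^ j).
Proof.
rewrite /log_sum (eq_bigr (fun e => \sum_(0 <= p < x.+1 | prime p)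
   \sum_(1 <= j < x.+1) ln p%:R *
     \sum_(1 <= m < ((x %/ p ^ j) %/ e.1).+1) e.2`_((m * (p ^ j * r)) %% q))).
  rewrite exchange_big; apply: eq_bigr => p _; rewrite exchange_big.
  by apply: eq_bigr => j _; rewrite -mulr_sumr.
move=> e _; rewrite (sum_ln_prime_powers (fun n => e.2`_((n * r) %% q)) (leq_div x e.1)).
apply: eq_bigr => p _; apply: eq_bigr => j _; congr (_ * _).
by rewrite -!divnMA mulnC; apply: eq_bigr => m _; rewrite mulnA.
Qed.

Lemma log_sum_residues x : log_sum x =
  \sum_(e <- K) \sum_(a < q) e.2`_a * theta_res q r a (x %/ e.1).
Proof.
apply: eq_bigr => e _; symmetry.
under eq_bigr => a _ do rewrite /theta_res mulr_sumr big_mkcond.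
rewrite exchange_big; apply: eq_bigr => n _.
rewrite -big_mkcond /= (bigD1 (Ordinal (ltn_pmod (n * r) q0))) /= ?modn_mod //.
rewrite big1 ?addr0 // => a /andP[/eqP ea] /eqP; case.
by apply: val_inj; rewrite /= ea modn_small.
Qed.

Definition coef_total (e : nat * seq R) : R := \sum_(a < q) e.2`_a.
Definition coef_norm := \sum_(e <- K) \sum_(a < q) `|e.2`_a|.

(** Each q T(x / k; a) is replaced by [stirling (x / k)] = (x / k)(ln x - 1) - (x / k) ln k. The
    vanishing drift cancels the part in x (ln x - 1), and only a linear main term remains. *)
Lemma log_sum_ge x : {in K, forall e, (0 < e.1 <= x)%N} ->
  \sum_(e <- K) coef_total e / e.1%:R = 0 ->
  - (x%:R * \sum_(e <- K) coef_total e / e.1%:R * ln e.1%:R)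
    - coef_norm * (q.+1%:R * ln x%:R + (q ^ 3).+1%:R) <= q%:R * log_sum x.
Proof.
move=> Kx drift; set E := _ + (q ^ 3).+1%:R.
have hst : \sum_(e <- K) coef_total e * stirling (x%:R / e.1%:R) =
    - (x%:R * \sum_(e <- K) coef_total e / e.1%:R * ln e.1%:R).
  transitivity (\sum_(e <- K) ((x%:R * (ln x%:R - 1)) * (coef_total e / e.1%:R)
      - x%:R * (coef_total e / e.1%:R * ln e.1%:R))).
    rewrite big_seq [RHS]big_seq; apply: eq_bigr => e /Kx /andP[k0 kx].
    have k0' : 0 < e.1%:R :> R by rewrite ltr0n.
    have x0' : 0 < x%:R :> R by rewrite ltr0n (leq_trans k0).
    rewrite /stirling lnM ?invr_gt0 // lnV //; field.
    by rewrite gt_eqF.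
  by rewrite sumrB -!mulr_sumr drift mulr0 add0r.
rewrite -hst log_sum_residues mulr_sumr /coef_norm mulr_suml -sumrB.
rewrite big_seq [leRHS]big_seq; apply: ler_sum => e /Kx kx.
rewrite /coef_total !mulr_suml -sumrB mulr_sumr; apply: ler_sum => a _.
have := theta_res_div a kx q0 qr; rewrite -/E => h.
have : `|e.2`_a * (q%:R * theta_res q r a (x %/ e.1) - stirling (x%:R / e.1%:R))| <= `|e.2`_a| * E.
  by rewrite normrM ler_wpM2l.
by rewrite ler_norml => /andP[h1 _]; lra.
Qed.

Variables (u v Y : nat) (s : R).
Hypotheses (u0 : (0 < u)%N) (Y0 : (0 < Y)%N) (s0 : 0 <= s).
Hypothesis weight_le : forall b y, (0 < y)%N ->
  weight b y <= ((b == 1 %[mod q]) && (u <= y < v))%N%:R + s * (Y <= y)%N%:R.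

(** For a prime p, the condition u <= x / p < v means x / v < p <= x / u, which is excluded by
    hypothesis when p r = 1 mod q. So j = 1 leaves only s theta(x / Y), and the powers j >= 2 cost
    about sqrt(x) ln x. *)
Lemma log_sum_le x M M' : (u <= x)%N -> (Y <= x)%N -> (x %/ u < M ^ 2)%N -> (x %/ Y < M' ^ 2)%N ->
  (forall p, prime p -> (p * r == 1 %[mod q])%N -> (x < v * p)%N -> ~~ (u * p <= x)%N) ->
  log_sum x <= (M%:R + s * M'%:R) * ln x%:R + s * ((2 * (x %/ Y))%:R * ln 2).
Proof.
move=> ux Yx xM xM' noprime.
have x0 : (0 < x)%N by apply: leq_trans ux.
have div_in k : (0 < k <= x)%N -> (0 < x %/ k <= x)%N.
  by case/andP=> k0 kx; rewrite divn_gt0 // kx leq_div.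
have hpu : (0 < x %/ u <= x)%N by apply: div_in; rewrite u0.
have hpY : (0 < x %/ Y <= x)%N by apply: div_in; rewrite Y0.
have hp1 := sum_higher_prime_powers_le hpu xM.
have hp2 := sum_higher_prime_powers_le hpY xM'.
have lnu : ln (x %/ u)%:R <= ln x%:R by apply: ler_ln_nat; case/andP: hpu.
have lnY : ln (x %/ Y)%:R <= ln x%:R by apply: ler_ln_nat; case/andP: hpY.
(* Y <= x / p is equivalent to p <= x / Y. *)
have tY : \sum_(0 <= p < x.+1 | prime p) ln p%:R * (Y <= x %/ p)%N%:R <= theta (x %/ Y).
  rewrite /theta (big_cat_nat _ (n := (x %/ Y).+1)) //=; last by rewrite ltnS leq_div.
  rewrite [X in _ + X]big_nat_cond [X in _ + X]big1 ?addr0.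
    apply: ler_sum => p pp; rewrite ler_piMr ?ln_nat_ge0 ?prime_gt0 //.
    by case: (Y <= _)%N.
  move=> p /andP[/andP[hp _] pp]; have p0 := prime_gt0 pp.
  rewrite leq_divRL // mulnC -leq_divRL //.
  by rewrite leqNgt hp mulr0.
have tl := le_trans tY (theta_le _).
(* Termwise comparison: j = 1 keeps only the part of the weight bound beyond Y, while j >= 2 takes
   both parts. *)
apply: (@le_trans _ _ (\sum_(0 <= p < x.+1 | prime p)
   (s * (ln p%:R * (Y <= x %/ p)%N%:R) +
    (\sum_(2 <= j < x.+1) (p ^ j <= x %/ u)%:R * ln p%:R +
     s * \sum_(2 <= j < x.+1) (p ^ j <= x %/ Y)%:R * ln p%:R)))); last first.
  rewrite !big_split /= -!mulr_sumr addrC mulrDl lerD // ?ler_wpM2l //.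
  apply: lerD; first by apply: le_trans hp1 _; rewrite ler_wpM2l.
  by rewrite -mulrA ler_wpM2l // (le_trans hp2) // ler_wpM2l.
rewrite log_sum_weight big_nat_cond [leRHS]big_nat_cond.
apply: ler_sum => p /andP[/andP[_ px] pp].
have p0 := prime_gt0 pp; have lnp0 := ln_nat_ge0 p0.
have w0 b : weight b 0 = 0.
  by rewrite /weight big1 // => e _; rewrite div0n big_geq.
rewrite big_ltn ?ltnS // expn1 lerD //.
  rewrite mulrCA ler_wpM2l //; have [y0|y0] := posnP (x %/ p).
    by rewrite y0 w0 mulr_ge0.
  apply: (le_trans (weight_le _ y0)).
  suff -> : ((p * r == 1 %[mod q]) && (u <= x %/ p < v))%N = false by rewrite add0r.
  apply/negbTE/negP => /and3P[hp h1 h2]; have := noprime p pp hp.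
  rewrite -ltn_divLR // -leq_divRL // => /(_ h2).
  by rewrite h1.
rewrite mulr_sumr -big_split /=; apply: ler_sum => j _.
have pj0 : (0 < p ^ j)%N by rewrite expn_gt0 p0.
rewrite !leq_divRL // -![(p ^ j * _)%N]mulnC -!leq_divRL // mulrA -mulrDl mulrC ler_wpM2r //.
have [y0|y0] := posnP (x %/ p ^ j)%N; first by rewrite y0 w0 addr_ge0 // mulr_ge0.
apply: (le_trans (weight_le _ y0)); rewrite lerD //.
have hb (a1 a2 a3 : bool) : (a1 && (a2 && a3) <= a2)%N by case: a1 a2 a3 => [] [] [].
by rewrite ler_nat hb.
Qed.

Variables (c : R) (w h0 : nat).
Hypotheses (u4 : (u <= 4)%N) (Y_ge : (u * 4 ^ w <= Y)%N).
Hypotheses (Y_le : (Y <= 4 ^ h0)%N) (w_le : (w <= h0)%N).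
Hypothesis K_le : {in K, forall e, (0 < e.1 <= 4 ^ h0)%N}.
Hypothesis drift : \sum_(e <- K) coef_total e / e.1%:R = 0.
Hypothesis main_term : \sum_(e <- K) coef_total e / e.1%:R * ln e.1%:R <= - (c * ln 2).
Hypothesis norm_le : coef_norm * (q + q ^ 3 + 2)%:R <= 2 ^+ h0.+1.
Hypothesis large_h0 : 8 * h0.+2%:R * (2 + q%:R * (1 + s / 2 ^+ w)) <
  (c - q%:R * s * 2 / Y%:R) * u%:R * 2 ^+ h0.+1.

(** With x = v B, the absence of such a prime makes the two bounds for [log_sum x] contradictory.
    Square roots are replaced by powers of 2: 2^h for sqrt(x / u) and 2^(h - w) for sqrt(x / Y). *)
Lemma exists_prime_in_range B : (u * 4 ^ h0 <= v * B)%N ->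
  exists p, [/\ prime p, (p * r == 1 %[mod q])%N, (B < p)%N & (u * p <= v * B)%N].
Proof.
move=> hx; set x := (v * B)%N in hx *.
have h4x : (4 ^ h0 <= x)%N by apply: leq_trans hx; rewrite leq_pmull.
have x0 : (0 < x)%N by apply: leq_trans h4x; rewrite expn_gt0.
have v0 : (0 < v)%N by move: x0; rewrite muln_gt0 => /andP[].
have Yx : (Y <= x)%N by apply: leq_trans h4x.
have hxu : (4 ^ h0 <= x %/ u)%N by rewrite leq_divRL // mulnC.
have xu0 : (0 < x %/ u)%N by apply: leq_trans hxu; rewrite expn_gt0.
have ux : (u <= x)%N by rewrite -divn_gt0.
case: (boolP [exists p : 'I_x.+1,
   [&& prime p, p * r == 1 %[mod q], B < p & u * p <= x]%N]).
  by case/existsP => p /and4P[? ? ? ?]; exists p.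
rewrite negb_exists => /forallP no; exfalso.
have noprime p : prime p -> (p * r == 1 %[mod q])%N -> (x < v * p)%N -> ~~ (u * p <= x)%N.
  rewrite ltn_pmul2l // => pp pr Bp; apply/negP => up.
  have px : (p < x.+1)%N by rewrite ltnS (leq_trans _ up) // leq_pmull.
  by have := no (Ordinal px); rewrite /= pp pr Bp up.
(* Thus 4^(h - 1) <= x / u < 4^h. *)
set h := (trunc_log 4 (x %/ u)).+1.
have hh : (h0 < h)%N by rewrite ltnS trunc_log_max.
have xM4 : (x %/ u < 4 ^ h)%N by rewrite trunc_log_ltn.
have xM : (x %/ u < (2 ^ h) ^ 2)%N by rewrite -expnM mulnC expnM.
have xu : (x < u * 4 ^ h)%N by rewrite mulnC -ltn_divLR.
have wh : (w <= h)%N by apply: leq_trans w_le (ltnW hh).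
have xM' : (x %/ Y < (2 ^ (h - w)) ^ 2)%N.
  rewrite -expnM mulnC expnM ltn_divLR //; apply: leq_trans xu _.
  by rewrite -{1}(subnK wh) expnD mulnCA leq_pmul2l ?expn_gt0.
have xm : (u * 4 ^ h <= 4 * x)%N.
  rewrite expnS mulnCA leq_pmul2l // mulnC -leq_divRL //.
  by rewrite trunc_logP.
have hle := log_sum_le ux Yx xM xM' noprime.
have Kx : {in K, forall e, (0 < e.1 <= x)%N}.
  by move=> e /K_le /andP[-> /leq_trans->].
have hge := log_sum_ge Kx drift.
have ln20 : 0 < ln 2 by have := ln2_ge; lra.
have lnx : ln x%:R <= (2 * h.+1)%:R * ln 2.
  rewrite mulr_natl -lnX ?ltr0n // -natrX expnM.
  apply: ler_ln_nat => //; apply: leq_trans (ltnW xu) _.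
  by rewrite expnS leq_mul2r u4 orbT.
set D := c - q%:R * s * 2 / Y%:R.
have hY : (2 * (x %/ Y))%:R <= 2 * x%:R / Y%:R :> R.
  by rewrite ler_pdivlMr ?ltr0n // -!natrM ler_nat -mulnA leq_mul2l leq_trunc_div.
have N0 : 0 <= coef_norm.
  by apply: sumr_ge0 => e _; apply: sumr_ge0 => a _; apply: normr_ge0.
have s'0 : 0 <= s / 2 ^+ w by rewrite divr_ge0 // exprn_ge0.
set sw := s / 2 ^+ w in s'0 *.
have eM' : s * (2 ^ (h - w))%:R = sw * (2 ^ h)%:R.
  by rewrite -{2}(subnK wh) expnD natrM !natrX /sw; field; rewrite expf_neq0 ?pnatr_eq0.
rewrite eM' in hle.
(* [large_h0] is the case h = h0 + 1. It persists for larger h because the left side is linear in h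
   while the right side doubles. *)
have step : 8 * h.+1%:R * (2 + q%:R * (1 + sw)) < D * u%:R * 2 ^+ h.
  have C0 : 0 <= 2 + q%:R * (1 + sw) by rewrite addr_ge0 // mulr_ge0 // addr_ge0.
  have := large_h0; rewrite -/sw -/D.
  have : (h0.+1 <= h)%N by [].
  elim: (h) => // h' IH; rewrite leq_eqVlt => /orP[/eqP[<-]//|hlt] hl.
  have {}IH := IH hlt hl; have : 1 <= h'.+1%:R :> R by rewrite ler1n.
  by move=> /(ler_wpM2r C0); rewrite exprS -[h'.+2%:R]natr1; lra.
have normh : coef_norm * (q + q ^ 3 + 2)%:R <= 2 ^+ h.
  by apply: le_trans norm_le _; rewrite ler_eXn2l ?ltr1n.
have mt := main_term; set l := ln 2 in ln20 lnx mt hle.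
set P := (2 ^ h)%:R in hle *; set H := h.+1%:R in step *.
have P0 : 0 < P by rewrite /P ltr0n expn_gt0.
have eP : 2 ^+ h = P by rewrite /P natrX.
rewrite eP in step normh.
have H1 : 1 <= H by rewrite /H ler1n.
have Q0 : 0 <= q%:R * (1 + sw) by rewrite mulr_ge0 // addr_ge0.
have U0 : 0 < u%:R :> R by rewrite ltr0n.
have D0 : 0 < D.
  have : 0 < D * u%:R * P by apply: le_lt_trans step; rewrite !mulr_ge0 // ?addr_ge0 // ler0n.
  by rewrite !pmulr_lgt0.
set X := x%:R in hge hle hY *.
have PX : u%:R * (P * P) <= 4 * X.
  by rewrite /P /X -!natrM ler_nat; apply: leq_trans xm; rewrite -expnMn.
have {lnx} lnx : ln X <= 2 * H * l by move: lnx; rewrite natrM -/H.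
have e1 : X * (c * l) <= - (X * \sum_(e <- K) coef_total e / e.1%:R * ln e.1%:R).
  by rewrite -mulrN ler_wpM2l // ?ler0n //; lra.
have l1 : 1 <= 2 * l := ln2_ge.
(* The constant q^3 + 1 is absorbed since H and 2 ln 2 are at least 1; [normh] then bounds the
   norm. *)
have e2 : coef_norm * (q.+1%:R * ln X + (q ^ 3).+1%:R) <= 2 * H * P * l.
  have : q.+1%:R * ln X + (q ^ 3).+1%:R <= (q + q ^ 3 + 2)%:R * (2 * H * l).
    have -> : (q + q ^ 3 + 2 = q.+1 + (q ^ 3).+1)%N by rewrite addn2 addSn addnS.
    rewrite natrD mulrDl lerD ?ler_wpM2l // ?ler0n // ler_peMr ?ler0n //.
    have : 1 * (2 * l) <= H * (2 * l) by rewrite ler_wpM2r //; lra.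
    lra.
  move=> /(ler_wpM2l N0) /le_trans; apply.
  have h2l : 0 <= 2 * H * l by rewrite !mulr_ge0 ?ler0n //; lra.
  have := ler_wpM2r h2l normh; lra.
have e3 : (P + sw * P) * ln X <= (P + sw * P) * (2 * H * l).
  by have P0W := ltW P0; rewrite ler_wpM2l // addr_ge0 // mulr_ge0.
have e4 : s * ((2 * (x %/ Y))%:R * l) <= s * (2 * X / Y%:R * l).
  by rewrite ler_wpM2l // ler_wpM2r // ltW.
have e5 := ler_wpM2l (ler0n R q) (le_trans hle (lerD e3 e4)).
(* The terms linear in x are collected in D, the main constant c less the loss from theta(x / Y).
   Together with u P^2 <= 4 X this contradicts [step] multiplied by P. *)
have e6 : (X * D) * l <= (2 * H * P * (1 + q%:R * (1 + sw))) * l.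
  rewrite /D; lra.
have e7 : X * D <= 2 * H * P * (1 + q%:R * (1 + sw)) by rewrite -(ler_pM2r ln20).
have e8 := ler_wpM2r (ltW D0) PX.
have e9 : 8 * H * (2 + q%:R * (1 + sw)) * P < D * u%:R * P * P by rewrite ltr_pM2r.
have e10 : 0 <= H * P by rewrite mulr_ge0 ?ler0n // ltW.
lra.
Qed.

End Certificate.
End Chebyshev.

(** * Integer weights and their periodicity *)

Lemma N_to_nat_div_mod (a b : BinNums.N) : (0 < BinNat.N.to_nat b)%N ->
  BinNat.N.to_nat (BinNat.N.div a b) = (BinNat.N.to_nat a %/ BinNat.N.to_nat b)%N /\
  BinNat.N.to_nat (BinNat.N.modulo a b) = (BinNat.N.to_nat a %% BinNat.N.to_nat b)%N.
Proof.
move=> b0; have bn0 : b <> BinNums.N0 by move=> e; rewrite e in b0.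
have e := BinNat.N.div_mod a b bn0; have l := BinNat.N.mod_lt a b bn0.
set d := BinNat.N.div a b in e *; set m := BinNat.N.modulo a b in e l *.
have e' : BinNat.N.to_nat a = (BinNat.N.to_nat d * BinNat.N.to_nat b + BinNat.N.to_nat m)%N by lia.
have l' : (BinNat.N.to_nat m < BinNat.N.to_nat b)%N by lia.
by rewrite e' divnMDl // modnMDl divn_small // modn_small // addn0.
Qed.

Section IntegerWeight.
Variables (q : nat) (C : seq (nat * seq BinNums.Z)).

Definition zweight b y : BinNums.Z :=
  \sum_(e <- C) \sum_(1 <= m < (y %/ e.1).+1) e.2`_((m * b) %% q).

Definition zweight_step b y : BinNums.Z :=
  \sum_(e <- C) if (e.1 %| y)%N then e.2`_((y %/ e.1 * b) %% q) else 0.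

Lemma zweightS b y : all (fun e => 0 < e.1)%N C ->
  zweight b y.+1 = zweight b y + zweight_step b y.+1.
Proof.
move=> /allP C0; rewrite /zweight /zweight_step -big_split /=.
rewrite big_seq [RHS]big_seq; apply: eq_bigr => e /C0 e0.
rewrite divnS //; case: ifP => [h|_]; last by rewrite addr0.
by rewrite add1n big_nat_recr //= h add1n.
Qed.

Lemma zweight_mod b y : zweight b y = zweight (b %% q) y.
Proof.
by apply: eq_bigr => e _; apply: eq_bigr => m _; rewrite modnMmr.
Qed.

(** Adding P to y adds P / k to the number of summands. The shift is invisible modulo q if q divides
    P / k, and a constant row does not see it at all. *)
Definition periodic_entry P (e : nat * seq BinNums.Z) :=
  [&& (0 < e.1)%N, (e.1 %| P)%N & (q * e.1 %| P)%N || (e.2 == nseq q (head 0 e.2))].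

Lemma zweight_addP P b y : (0 < q)%N -> all (periodic_entry P) C ->
  zweight b (P + y) = zweight b P + zweight b y.
Proof.
move=> q0 /allP C0; rewrite /zweight -big_split /=.
rewrite big_seq [RHS]big_seq; apply: eq_bigr => e /C0 /and3P[k0 kP hc].
rewrite divnDl // (big_cat_nat _ (n := (P %/ e.1).+1)) //=; last by rewrite ltnS leq_addr.
congr (_ + _); rewrite -{1}(add1n (P %/ e.1)) big_addn -addnS addKn.
apply: eq_bigr => m _; case/orP: hc => [qP|/eqP->].
  have /dvdnP[c ->] : (q %| P %/ e.1)%N by rewrite dvdn_divRL.
  by rewrite mulnDl addnC -mulnA [(q * b)%N]mulnC mulnA modnMDl.
by rewrite !nth_nseq !ltn_pmod.
Qed.

Variables (u v Y : nat) (S s : BinNums.Z).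

Definition zbound b y : BinNums.Z :=
  (if (b == 1%N) && (u <= y < v)%N then S else 0) + (if (Y <= y)%N then s else 0).

(** A finite check suffices: W(b, P + y) = W(b, P) + W(b, y) with W(b, P) <= 0, so values beyond P
    are bounded by earlier ones. There the bound needed is s, which dominates [zbound] since v <= Y
    and S <= s. *)
Lemma zweight_le P : (1 < q)%N -> all (periodic_entry P) C -> [&& 0 < v, v <= Y & Y <= P]%N ->
  0 <= S <= s ->
  (forall b y, (b < q)%N -> (0 < y <= P)%N -> zweight b y <= zbound b y) ->
  (forall b, (b < q)%N -> zweight b P <= 0) ->
  forall b y, (0 < y)%N -> zweight b y <= zbound (b %% q)%N y.
Proof.
move=> q1 CP /and3P[v0 vY YP] /andP[S0 Ss] hP hP0 b y y0.
have q0 : (0 < q)%N by apply: ltn_trans q1.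
rewrite zweight_mod; have : (b %% q < q)%N by rewrite ltn_pmod.
move: (b %% q)%N => {}b bq.
have [yP|Py] := leqP y P; first by apply: hP; rewrite // y0.
suff h : forall b y, (b < q)%N -> (0 < y)%N -> zweight b y <= s.
  rewrite /zbound ifF; last by apply/negbTE; lia.
  by rewrite add0r (leq_trans YP (ltnW Py)) h.
move=> {}b {}y {}bq {Py} {}y0; have s0 := le_trans S0 Ss.
have [m] := ubnP y; elim: m y y0 => // m IH y y0 /ltnSE ym.
have [yP|Py] := leqP y P.
  apply: (le_trans (hP b y bq _)); rewrite ?y0 //.
  rewrite /zbound; case: ifP => [/and3P[_ _ h]|_].
    by rewrite ifF ?addr0 //; apply/negbTE; lia.
  by rewrite add0r; case: ifP.
rewrite -(subnKC (ltnW Py)) zweight_addP //.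
rewrite -[leRHS]add0r lerD ?hP0 // IH //; lia.
Qed.

End IntegerWeight.

(** * Incremental computation of all weights up to the period *)

Section Checker.
Variables (q : nat) (C : seq (nat * seq BinNums.Z)).
Fixpoint add_rows (w r : seq BinNums.Z) : seq BinNums.Z :=
  match w, r with
  | x :: w', y :: r' => BinInt.Z.add x y :: add_rows w' r'
  | _, _ => [::]
  end.

Lemma size_add_rows w r : size w = size r -> size (add_rows w r) = size w.
Proof. by elim: w r => [|x w IH] [|y r] //= [/IH->]. Qed.

Lemma nth_add_rows w r b : size w = size r -> nth 0 (add_rows w r) b = nth 0 w b + nth 0 r b.
Proof.
by elim: w r b => [|x w IH] [|y r] // [|b] //= [szw]; rewrite IH.
Qed.

Definition row (t : seq BinNums.Z) m := mkseq (fun b => t`_((m * b) %% q)) q.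

(* After y steps, an entry (k, t) is stored with the number of steps to the next
   multiple of k and with the rows to be added at the q next multiples of k. *)
Definition entry_state y (e : nat * seq BinNums.Z) : nat * (nat * seq (seq BinNums.Z)) :=
  (e.1.-1, (e.1.-1 - y %% e.1, mkseq (fun i => row e.2 (y %/ e.1 + i.+1)) q)%N).

(** A counter at 0 means that k divides the new y; the head row is then added and moved to the end.
    This rotation is correct because [row t m] depends on m only modulo q. *)
Fixpoint step_states (l : seq (nat * (nat * seq (seq BinNums.Z)))) w :=
  if l is (k1, (c, rs)) :: l' then
    let: (l'', w') := step_states l' w in
    if c is c'.+1 then ((k1, (c', rs)) :: l'', w')
    else ((k1, (k1, rcons (behead rs) (head [::] rs))) :: l'', add_rows w' (head [::] rs))
  else ([::], w).

Lemma step_statesE y w : (0 < q)%N -> all (fun e => 0 < e.1)%N C -> size w = q ->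
  exists w', [/\ step_states [seq entry_state y e | e <- C] w =
                   ([seq entry_state y.+1 e | e <- C], w'), size w' = q &
                 forall b, (b < q)%N -> nth 0 w' b = nth 0 w b + zweight_step q C b y.+1].
Proof.
move=> q0 + sw; elim: C => [|e C' IH] /=.
  by move=> _; exists w; split=> // b _; rewrite /zweight_step big_nil addr0.
case/andP=> e0 /IH {IH}[w' [-> sw' hw']].
rewrite {1 3}/entry_state.
have [hk|hk] := boolP (e.1 %| y.+1)%N.
  have m1 : (y %% e.1 = e.1.-1)%N.
    by move/dvdnP: hk => [[|c]] //; rewrite mulSn => hc; rewrite (_ : y = c * e.1 + e.1.-1)%N;
      [rewrite modnMDl modn_small; lia|lia].
  have m2 : (y.+1 %% e.1 = 0)%N by apply/eqP.
  have d2 : (y.+1 %/ e.1 = (y %/ e.1).+1)%N by rewrite divnS // hk.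
  rewrite m1 m2 subnn subn0 d2.
  have hd : head [::] (mkseq (fun i => row e.2 (y %/ e.1 + i.+1)) q) = row e.2 (y %/ e.1).+1.
    by rewrite -nth0 nth_mkseq // addn1.
  rewrite hd; exists (add_rows w' (row e.2 (y %/ e.1).+1)); split.
  - congr ((_, (_, _)) :: _, _).
    apply: (@eq_from_nth _ [::]); rewrite size_rcons size_behead !size_mkseq ?prednK // => i iq.
    rewrite nth_rcons size_behead size_mkseq nth_behead.
    have [ltq|geq] := ltnP i q.-1.
      by rewrite !nth_mkseq //; [rewrite addnS addSn|lia].
    have -> : i = q.-1 by lia.
    rewrite eqxx nth_mkseq ?prednK // /row; apply: eq_mkseq => b.
    by rewrite addnC mulnDl [(q * b)%N]mulnC modnMDl.
  - by rewrite size_add_rows ?size_mkseq.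
  move=> b bq; rewrite nth_add_rows ?size_mkseq // hw' // /zweight_step big_cons hk d2.
  by rewrite nth_mkseq // -addrA [X in _ + X = _]addrC.
have mS : (y.+1 %% e.1 = (y %% e.1).+1)%N.
  have h := ltn_pmod y e0; rewrite -addn1 -modnDml addn1 modn_small //.
  rewrite ltn_neqAle h andbT; apply: contra hk => /eqP h'.
  by rewrite /dvdn -addn1 -modnDml addn1 h' modnn.
have d2 : (y.+1 %/ e.1 = y %/ e.1)%N by rewrite divnS // (negbTE hk).
have -> : (e.1.-1 - y %% e.1 = (e.1.-1 - y.+1 %% e.1).+1)%N.
  by have h := ltn_pmod y.+1 e0; lia.
exists w'; split=> //; first by rewrite /entry_state d2.
by move=> b bq; rewrite hw' // /zweight_step big_cons (negbTE hk) add0r.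
Qed.

Variables (u v Y : BinNums.N) (S s : BinNums.Z).

Definition row_le (y : BinNums.N) (w : seq BinNums.Z) :=
  let c := if BinNat.N.leb Y y then s else BinNums.Z0 in
  let d := if BinNat.N.leb u y && BinNat.N.ltb y v then BinInt.Z.add S c else c in
  if w is w0 :: w1 :: w' then
    [&& BinInt.Z.leb w0 c, BinInt.Z.leb w1 d & all (fun x => BinInt.Z.leb x c) w']
  else false.

Lemma row_leP y w : row_le y w -> forall b, (b < size w)%N ->
  nth 0 w b <= zbound (BinNat.N.to_nat u) (BinNat.N.to_nat v) (BinNat.N.to_nat Y) S s b
                 (BinNat.N.to_nat y).
Proof.
case: w => [|w0 [|w1 w']] //= /and3P[h0 h1 /allP h2].
have eY : BinNat.N.leb Y y = (BinNat.N.to_nat Y <= BinNat.N.to_nat y)%N by lia.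
have eu : BinNat.N.leb u y && BinNat.N.ltb y v =
  (BinNat.N.to_nat u <= BinNat.N.to_nat y < BinNat.N.to_nat v)%N by lia.
rewrite eY eu in h0 h1 h2; rewrite /zbound => -[|[|b]] /= hb.
- by rewrite add0r; move: h0; case: (BinNat.N.to_nat Y <= _)%N; lia.
- by move: h1; case: (_ && _); case: (BinNat.N.to_nat Y <= _)%N; lia.
by rewrite add0r; apply: h2 (mem_nth 0 (hb : (b < size w')%N)).
Qed.

(** The test after the last step, that the weights at P are not positive, is what the reduction
    modulo the period requires. *)
Fixpoint check_rows n (y : BinNums.N) l w :=
  if n is n'.+1 then
    let y' := BinNat.N.succ y in
    let: (l', w') := step_states l w in
    row_le y' w' && check_rows n' y' l' w'
  else all (fun x => BinInt.Z.leb x BinNums.Z0) w.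

Lemma check_rowsP n y w : (1 < q)%N -> all (fun e => 0 < e.1)%N C ->
  size w = q -> (forall b, (b < q)%N -> nth 0 w b = zweight q C b (BinNat.N.to_nat y)) ->
  check_rows n y [seq entry_state (BinNat.N.to_nat y) e | e <- C] w ->
  and (forall b i, (b < q)%N -> (0 < i <= n)%N ->
     zweight q C b (BinNat.N.to_nat y + i)%N <=
     zbound (BinNat.N.to_nat u) (BinNat.N.to_nat v) (BinNat.N.to_nat Y) S s b (BinNat.N.to_nat y + i)%N)
  (forall b, (b < q)%N -> zweight q C b (BinNat.N.to_nat y + n)%N <= 0).
Proof.
move=> q1 C0; have q0 : (0 < q)%N by apply: ltn_trans q1.
elim: n y w => [|n IH] y w sw hw /=.
  move=> /allP h; split=> [b [|i] //|b bq]; rewrite addn0 -hw //.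
  by apply: h; rewrite mem_nth ?sw.
have [w' [-> sw' hw']] := step_statesE (BinNat.N.to_nat y) q0 C0 sw.
have {}hw' b : (b < q)%N -> nth 0 w' b = zweight q C b (BinNat.N.to_nat (BinNat.N.succ y)).
  by move=> bq; rewrite hw' // hw // Nnat.N2Nat.inj_succ zweightS.
case/andP=> hr; rewrite -Nnat.N2Nat.inj_succ => /(IH _ _ sw' hw')[h1 h2]; split; last first.
  by move=> b bq; have := h2 b bq; rewrite Nnat.N2Nat.inj_succ addSnnS.
move=> b [|[|i]] // bq hi; last first.
  by have := h1 b i.+1 bq; rewrite Nnat.N2Nat.inj_succ addSnnS; apply; lia.
rewrite addn1 -Nnat.N2Nat.inj_succ -hw' //.
by apply: row_leP => //; rewrite sw'.
Qed.
End Checker.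

(** * Drift, main term and norm of a certificate in integers *)

Definition ztotal (e : nat * seq BinNums.Z) : BinNums.Z := foldr BinInt.Z.add BinNums.Z0 e.2.

(** P times the sum of total(e) f(k) / k, without fractions when every k divides P. Taking f = 1
    gives the drift, and f = [logn p] the coefficient of ln p in the main term. *)
Definition zmoment (P : nat) (f : nat -> nat) (C : seq (nat * seq BinNums.Z)) : BinNums.Z :=
  foldr (fun e z => BinInt.Z.add (BinInt.Z.mul (ztotal e)
    (BinInt.Z.of_nat (P %/ e.1 * f e.1))) z) BinNums.Z0 C.

Definition znorm (C : seq (nat * seq BinNums.Z)) : BinNums.Z :=
  foldr (fun e z => BinInt.Z.add (foldr (fun c z => BinInt.Z.add (BinInt.Z.abs c) z)
    BinNums.Z0 e.2) z) BinNums.Z0 C.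

Section RealCertificate.
Variables (R : realFieldType) (ln : R -> R).
Hypothesis lnM : forall x y : R, 0 < x -> 0 < y -> ln (x * y) = ln x + ln y.
Hypothesis ln_subr1 : forall x : R, 0 < x -> ln x <= x - 1.

Definition ZtoR (z : BinNums.Z) : R := (int_of_Z z)%:~R.

Lemma ZtoRD a b : ZtoR (BinInt.Z.add a b) = ZtoR a + ZtoR b.
Proof. by rewrite -intrD -rmorphD. Qed.

Lemma ZtoRM a b : ZtoR (BinInt.Z.mul a b) = ZtoR a * ZtoR b.
Proof. by rewrite -intrM -rmorphM. Qed.

Lemma ZtoR_nat n : ZtoR (BinInt.Z.of_nat n) = n%:R.
Proof. by rewrite /ZtoR (_ : int_of_Z _ = n%:Z) //; lia. Qed.

Lemma ZtoR_le a b : ZtoR a <= ZtoR b = BinInt.Z.leb a b.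
Proof. by rewrite /ZtoR ler_int; lia. Qed.

Lemma ZtoR_sum (I : Type) (l : seq I) (P : pred I) (F : I -> BinNums.Z) :
  ZtoR (\sum_(i <- l | P i) F i) = \sum_(i <- l | P i) ZtoR (F i).
Proof. by rewrite /ZtoR !rmorph_sum. Qed.

Variables (q : nat) (C : seq (nat * seq BinNums.Z)) (S : BinNums.Z).
Hypothesis S0 : BinInt.Z.lt BinNums.Z0 S.
Let S0' : 0 < ZtoR S.
Proof. by rewrite ltNge -[0 : R]/(ZtoR BinNums.Z0) ZtoR_le; lia. Qed.

Definition rcert : seq (nat * seq R) :=
  [seq (e.1, [seq ZtoR c / ZtoR S | c <- e.2]) | e <- C].

Lemma nth_rcert (l : seq BinNums.Z) i :
  [seq ZtoR c / ZtoR S | c <- l]`_i = ZtoR l`_i / ZtoR S.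
Proof.
have [il|li] := ltnP i (size l); first by rewrite (nth_map 0).
by rewrite !nth_default ?size_map // /ZtoR mul0r.
Qed.

Lemma weight_rcert b y : weight q rcert b y = ZtoR (zweight q C b y) / ZtoR S.
Proof.
rewrite /weight /rcert big_map /zweight ZtoR_sum mulr_suml.
apply: eq_bigr => e _; rewrite ZtoR_sum mulr_suml /=.
by apply: eq_bigr => m _; rewrite nth_rcert.
Qed.

Hypothesis C_size : all (fun e => size e.2 == q) C.

Lemma ztotalE e : e \in C -> \sum_(a < q) e.2`_a = ztotal e.
Proof.
move=> /(allP C_size)/eqP <-.
rewrite -(big_mkord xpredT (fun a => e.2`_a)) -(big_nth 0 xpredT id).
by rewrite /ztotal; elim: (e.2) => [|c l IH]; rewrite ?big_nil // big_cons IH.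
Qed.

Lemma coef_total_rcert e : e \in C ->
  coef_total q (e.1, [seq ZtoR c / ZtoR S | c <- e.2]) = ZtoR (ztotal e) / ZtoR S.
Proof.
move=> eC; rewrite /coef_total -ztotalE // ZtoR_sum mulr_suml.
by apply: eq_bigr => a _; rewrite nth_rcert.
Qed.

Lemma norm_rcert : coef_norm q rcert = ZtoR (znorm C) / ZtoR S.
Proof.
rewrite /coef_norm /rcert big_map (_ : znorm C = \sum_(e <- C) \sum_(a < q) BinInt.Z.abs e.2`_a).
  rewrite ZtoR_sum mulr_suml; apply: eq_bigr => e _; rewrite ZtoR_sum mulr_suml.
  apply: eq_bigr => a _; rewrite nth_rcert normrM normfV (gtr0_norm S0').
  by congr (_ / _); rewrite /ZtoR -intr_norm; congr intmul; lia.
move: C_size; elim: (C) => [|e l IH] /=; first by rewrite big_nil.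
case/andP=> /eqP sz /IH ->; rewrite big_cons.
congr (_ + _); rewrite -(big_mkord xpredT (fun a => BinInt.Z.abs e.2`_a)).
rewrite -sz -(big_nth 0 xpredT BinInt.Z.abs).
by elim: (e.2) => [|c l' IH']; rewrite ?big_nil // big_cons /= IH'.
Qed.

Variable P : nat.
Hypothesis P0 : (0 < P)%N.
Hypothesis CP : all (fun e => (0 < e.1)%N && (e.1 %| P)%N) C.

Lemma moment_rcert (f : nat -> nat) :
  \sum_(e <- rcert) coef_total q e / e.1%:R * (f e.1)%:R =
    ZtoR (zmoment P f C) / (ZtoR S * P%:R).
Proof.
have P0' : P%:R != 0 :> R by rewrite pnatr_eq0 -lt0n.
rewrite /rcert big_map (_ : zmoment P f C = \sum_(e <- C)
   BinInt.Z.mul (ztotal e) (BinInt.Z.of_nat (P %/ e.1 * f e.1))); last first.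
  by elim: C => [|e l IH]; rewrite ?big_nil // big_cons /= IH.
rewrite ZtoR_sum mulr_suml big_seq [RHS]big_seq; apply: eq_bigr => e eC /=.
have /andP[e0 eP] := allP CP e eC.
have e0' : e.1%:R != 0 :> R by rewrite pnatr_eq0 -lt0n.
have hP : P%:R = (P %/ e.1)%:R * e.1%:R :> R by rewrite -natrM divnK.
rewrite coef_total_rcert // ZtoRM ZtoR_nat natrM.
have hP' : (P %/ e.1)%:R != 0 :> R by move: P0'; rewrite hP mulf_eq0 => /norP[].
rewrite hP; field; rewrite e0' hP' gt_eqF //.
Qed.

Definition zlog (C : seq (nat * seq BinNums.Z)) p := zmoment P (logn p) C.

Hypothesis C_smooth : all (fun e =>
  e.1 == 2 ^ logn 2 e.1 * 3 ^ logn 3 e.1 * 5 ^ logn 5 e.1 * 7 ^ logn 7 e.1)%N C.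

(** Every k has only the prime factors 2, 3, 5 and 7, so ln k splits into their logarithms. *)
Lemma ln_moment_rcert : \sum_(e <- rcert) coef_total q e / e.1%:R * ln e.1%:R =
  (ZtoR (zlog C 2) * ln 2 + ZtoR (zlog C 3) * ln 3 + ZtoR (zlog C 5) * ln 5
    + ZtoR (zlog C 7) * ln 7) / (ZtoR S * P%:R).
Proof.
have D0 : ZtoR S * P%:R != 0 by rewrite mulf_neq0 ?gt_eqF // ltr0n.
rewrite !mulrDl ![_ * ln _ / _]mulrAC -!moment_rcert !mulr_suml -!big_split /=.
rewrite /rcert !big_map big_seq [RHS]big_seq; apply: eq_bigr => e eC /=.
rewrite {3}(eqP (allP C_smooth e eC)) !natrM !natrX.
rewrite !lnM ?mulr_gt0 ?exprn_gt0 ?ltr0n // !lnX ?ltr0n //.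
by rewrite -!(mulr_natr (ln _)); ring.
Qed.

Lemma ln_pow_le a m b n : (0 < a)%N -> (0 < b)%N -> (a ^ m <= b ^ n)%N ->
  m%:R * ln a%:R <= n%:R * ln b%:R.
Proof.
move=> a0 b0 h; rewrite !mulr_natl -!(lnX lnM) ?ltr0n // -!natrX.
by apply: (ler_ln_nat lnM ln_subr1); rewrite // expn_gt0 a0.
Qed.

(** For an upper bound of z x, the upper estimate of x is taken when z >= 0 and the lower one when z
    < 0. *)
Definition zscale (lo hi : nat) (z : BinNums.Z) : BinNums.Z :=
  BinInt.Z.mul (BinInt.Z.of_nat (if BinInt.Z.leb BinNums.Z0 z then hi else lo)) z.

Lemma zscale_le lo hi z x l : lo%:R * l <= 420 * x <= hi%:R * l ->
  420 * (ZtoR z * x) <= ZtoR (zscale lo hi z) * l.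
Proof.
case/andP=> hl hh; rewrite /zscale ZtoRM ZtoR_nat.
have e0 : ZtoR BinNums.Z0 = 0 by [].
case: ifP => hz.
  have z0 : 0 <= ZtoR z by rewrite -e0 ZtoR_le.
  have := ler_wpM2l z0 hh; lra.
have z0 : ZtoR z <= 0 by rewrite -e0 ZtoR_le; lia.
have := ler_wnM2l z0 hl; lra.
Qed.

(* The pairs (lo, hi) enclose 420 log a / log 2 for a = 3, 5, 7, because
   2^11 <= 3^7, 3^5 <= 2^8, 2^9 <= 5^4, 5^3 <= 2^7, 2^14 <= 7^5, 7 <= 2^3. *)
Definition zmain : BinNums.Z :=
  BinInt.Z.add
    (BinInt.Z.add (BinInt.Z.mul (BinInt.Z.of_nat 420%N) (zlog C 2)) (zscale 660%N 672%N (zlog C 3)))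
    (BinInt.Z.add (zscale 945%N 980%N (zlog C 5)) (zscale 1176%N 1260%N (zlog C 7))).

Lemma main_term_rcert : \sum_(e <- rcert) coef_total q e / e.1%:R * ln e.1%:R <=
  ZtoR zmain / 420 / (ZtoR S * P%:R) * ln 2.
Proof.
have D0 : 0 < ZtoR S * P%:R by rewrite mulr_gt0 // ltr0n.
rewrite ln_moment_rcert mulrAC ler_wpM2r ?invr_ge0 ?(ltW D0) //.
have l3a := @ln_pow_le 2 11 3 7 isT isT isT.
have l3b := @ln_pow_le 3 5 2 8 isT isT isT.
have l5a := @ln_pow_le 2 9 5 4 isT isT isT.
have l5b := @ln_pow_le 5 3 2 7 isT isT isT.
have l7a := @ln_pow_le 2 14 7 5 isT isT isT.
have l7b := @ln_pow_le 7 1 2 3 isT isT isT.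
have h3 : 420 * (ZtoR (zlog C 3) * ln 3) <= ZtoR (zscale 660%N 672%N (zlog C 3)) * ln 2.
  by apply: zscale_le; apply/andP; split; lra.
have h5 : 420 * (ZtoR (zlog C 5) * ln 5) <= ZtoR (zscale 945%N 980%N (zlog C 5)) * ln 2.
  by apply: zscale_le; apply/andP; split; lra.
have h7 : 420 * (ZtoR (zlog C 7) * ln 7) <= ZtoR (zscale 1176%N 1260%N (zlog C 7)) * ln 2.
  by apply: zscale_le; apply/andP; split; lra.
rewrite /zmain !ZtoRD ZtoRM ZtoR_nat.
lra.
Qed.

End RealCertificate.

(** The hypotheses of [exists_prime_in_range] with denominators cleared, for c = c0 / (S P) and with
    s / S for its s. Comparing Y and k with 4^6 and 4^5 instead of 4^h0 keeps the unary numbers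
    small. *)
Definition certificate_ok (q : nat) (C : seq (nat * seq BinNums.Z)) (S s : BinNums.Z)
    (u v Y P w h0 : nat) (c0 : BinNums.Z) : bool :=
  let z := BinInt.Z.of_nat in
  let z2 n := BinInt.Z.pow (z 2%N) (z n) in
  [&& [&& (1 < q)%N, (0 < u <= 4)%N, (0 < v <= Y)%N, (Y <= P)%N, (u * 4 ^ w <= Y <= 4 ^ 6)%N &
        (6 <= h0)%N && (w <= h0)%N],
      BinInt.Z.ltb BinNums.Z0 S, BinInt.Z.leb S s,
      all (periodic_entry q P) C, all (fun e => size e.2 == q) C,
      all (fun e => e.1 <= 4 ^ 5)%N C,
      all (fun e => e.1 == 2 ^ logn 2 e.1 * 3 ^ logn 3 e.1 * 5 ^ logn 5 e.1 * 7 ^ logn 7 e.1)%N C,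
      BinInt.Z.eqb (zmoment P (fun=> 1%N) C) BinNums.Z0,
      BinInt.Z.leb (zmain C P) (BinInt.Z.opp (BinInt.Z.mul (z 420%N) c0)),
      BinInt.Z.leb (BinInt.Z.mul (znorm C) (z (q + q ^ 3 + 2)%N)) (BinInt.Z.mul S (z2 h0.+1)),
      BinInt.Z.ltb
        (BinInt.Z.mul (z (8 * h0.+2)%N) (BinInt.Z.mul
           (BinInt.Z.add (BinInt.Z.mul (z (2 + q)%N) (BinInt.Z.mul S (z2 w))) (BinInt.Z.mul (z q) s))
           (BinInt.Z.mul (z P) (z Y))))
        (BinInt.Z.mul
           (BinInt.Z.sub (BinInt.Z.mul c0 (z Y)) (BinInt.Z.mul (z (2 * q)%N) (BinInt.Z.mul s (z P))))
           (BinInt.Z.mul (z u) (BinInt.Z.mul (z2 h0.+1) (z2 w))))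
    & check_rows (BinNat.N.of_nat u) (BinNat.N.of_nat v) (BinNat.N.of_nat Y) S s P BinNums.N0
        [seq entry_state q 0 e | e <- C] (nseq q BinNums.Z0)].

Lemma Zlt_of_ltb S : BinInt.Z.ltb BinNums.Z0 S -> BinInt.Z.lt BinNums.Z0 S.
Proof. by lia. Qed.

Lemma Zle_of_ltb (S s : BinNums.Z) :
  BinInt.Z.ltb BinNums.Z0 S -> BinInt.Z.leb S s -> 0 <= S <= s.
Proof. by move=> ? ?; apply/andP; split; lia. Qed.

Lemma ZtoRN (R : realFieldType) a : ZtoR R (BinInt.Z.opp a) = - ZtoR R a.
Proof. by rewrite -intrN -rmorphN. Qed.

Lemma ZtoR_gt0 (R : realFieldType) S : BinInt.Z.ltb BinNums.Z0 S -> 0 < ZtoR R S.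
Proof. by move=> S0; rewrite ltNge -[0]/(ZtoR R BinNums.Z0) ZtoR_le; lia. Qed.

Lemma exists_prime_of_certificate (R : realFieldType) (ln : R -> R)
    (lnM : forall x y : R, 0 < x -> 0 < y -> ln (x * y) = ln x + ln y)
    (ln_subr1 : forall x : R, 0 < x -> ln x <= x - 1) q C S s u v Y P w h0 c0 r B :
  certificate_ok q C S s u v Y P w h0 c0 -> coprime q r -> (u * 4 ^ h0 <= v * B)%N ->
  exists p, [/\ prime p, (p * r == 1 %[mod q])%N, (B < p)%N & (u * p <= v * B)%N].
Proof.
case/andP=> /and5P[q1 /andP[u0 u4] /andP[v0 vY] YP /andP[/andP[wY Y46] /andP[h6 wh]]].
case/and5P=> S0 Ss Cper Csize /and5P[Cle Csmooth drift main /and3P[norm large check]].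
move=> qr; have q0 : (0 < q)%N by apply: ltn_trans q1.
have Y0 : (0 < Y)%N := leq_trans v0 vY.
have P0 : (0 < P)%N := leq_trans Y0 YP.
have S0' := Zlt_of_ltb S0.
have e0 : ZtoR R BinNums.Z0 = 0 by [].
have SR0 : 0 < ZtoR R S by exact: ZtoR_gt0.
have PR0 : 0 < P%:R :> R by rewrite ltr0n.
have YR0 : 0 < Y%:R :> R by rewrite ltr0n.
have Ss' : ZtoR R S <= ZtoR R s by rewrite ZtoR_le.
have CP : all (fun e => (0 < e.1)%N && (e.1 %| P)%N) C.
  by apply: sub_all Cper => e /and3P[-> ->].
have C0 : all (fun e => 0 < e.1)%N C by apply: sub_all Cper => e /and3P[].
have ZpowR n : ZtoR R (BinInt.Z.pow (BinInt.Z.of_nat 2%N) (BinInt.Z.of_nat n)) = 2 ^+ n.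
  elim: n => [|n IH] //; rewrite exprS -IH -(ZtoR_nat R 2) -ZtoRM; congr ZtoR.
  by rewrite (Znat.Nat2Z.inj_succ n) BinInt.Z.pow_succ_r //; apply: Znat.Nat2Z.is_nonneg.
have w0 b : (b < q)%N -> nth 0 (nseq q BinNums.Z0) b = zweight q C b (BinNat.N.to_nat BinNums.N0).
  move=> bq; rewrite nth_nseq bq /zweight big1 // => e _.
  by rewrite div0n big_geq.
have [hP hP0] := check_rowsP q1 C0 (size_nseq _ _) w0 check.
rewrite !Nnat.Nat2N.id /= in hP hP0.
have v0Y : [&& 0 < v, v <= Y & Y <= P]%N by rewrite v0 vY.
have S0s := Zle_of_ltb S0 Ss.
have wle := zweight_le q1 Cper v0Y S0s hP hP0.
have {}wle b y : (0 < y)%N -> weight q (rcert R C S) b y <=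
    ((b == 1 %[mod q]) && (u <= y < v))%N%:R + ZtoR R s / ZtoR R S * (Y <= y)%N%:R.
  move=> y0; rewrite weight_rcert ler_pdivrMr // mulrDl mulrAC divfK ?(gt_eqF SR0) //.
  apply: (@le_trans _ _ (ZtoR R (zbound u v Y S s (b %% q)%N y))).
    by rewrite ZtoR_le; apply: wle.
  rewrite /zbound [X in ZtoR R X]/(BinInt.Z.add _ _) ZtoRD (modn_small q1).
  by case: ifP => _; case: (Y <= y)%N; rewrite ?mul1r ?mul0r ?mulr1 ?mulr0 ?e0.
have s0 : 0 <= ZtoR R s / ZtoR R S by rewrite divr_ge0 ?(ltW SR0) // (le_trans (ltW SR0)).
pose c := ZtoR R c0 / (ZtoR R S * P%:R).
apply: (@exists_prime_in_range R ln lnM ln_subr1 q r (rcert R C S) q0 qr u v Y _ u0 Y0 s0 wle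
  c w h0 u4 wY _ wh).
- by apply: leq_trans Y46 _; rewrite leq_exp2l.
- move=> _ /mapP[e eC ->] /=; rewrite (allP C0 e eC) /=.
  by apply: leq_trans (allP Cle e eC) _; rewrite leq_exp2l // ltnW.
- have := moment_rcert R S0' Csize P0 CP (fun=> 1%N).
  under eq_bigr => e _ do rewrite mulr1.
  by move=> ->; rewrite (_ : zmoment _ _ _ = BinNums.Z0) ?mul0r //; apply/BinInt.Z.eqb_eq.
- apply: (le_trans (main_term_rcert lnM ln_subr1 S0' Csize P0 CP Csmooth)).
  have hm : ZtoR R (zmain C P) <= - (420 * ZtoR R c0).
    rewrite -[420](ZtoR_nat R 420%N) -ZtoRM.
    by rewrite -ZtoRN ZtoR_le.
  have l2 : 0 <= ln 2 by apply: (ln_ge0 lnM ln_subr1); rewrite ler1n.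
  rewrite -mulNr ler_wpM2r // /c -mulNr ler_wpM2r ?invr_ge0 ?(ltW (mulr_gt0 SR0 PR0)) //.
  by rewrite ler_pdivrMr // mulNr mulrC.
- rewrite (norm_rcert R S0' Csize).
  rewrite mulrAC ler_pdivrMr // -ZpowR -ZtoR_nat -!ZtoRM ZtoR_le.
  by rewrite [X in BinInt.Z.leb _ X]BinInt.Z.mul_comm.
have : 8 * h0.+2%:R * (((2 + q%:R) * (ZtoR R S * 2 ^+ w) + q%:R * ZtoR R s) * (P%:R * Y%:R)) <
   (ZtoR R c0 * Y%:R - 2 * q%:R * (ZtoR R s * P%:R)) * (u%:R * (2 ^+ h0.+1 * 2 ^+ w)).
  rewrite -!ZpowR -(natrM _ 8) -(natrM _ 2) -natrD -!ZtoR_nat -!ZtoRM -!ZtoRD -!ZtoRM.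
  rewrite -ZtoRN -ZtoRD -ZtoRM.
  by rewrite ltNge ZtoR_le -BinInt.Z.ltb_antisym.
(* The common denominator of [large_h0]. *)
have D0 : 0 < ZtoR R S * P%:R * Y%:R * 2 ^+ w by rewrite !mulr_gt0 // exprn_gt0.
have n0 : [&& ZtoR R S != 0, P%:R != 0 :> R, Y%:R != 0 :> R & 2 ^+ w != 0 :> R].
  by rewrite !gt_eqF // exprn_gt0.
move=> h; rewrite -(ltr_pM2r D0); move: h; congr (_ < _).
  by field; case/and4P: n0 => h1 h2 h3 h4; rewrite ?h1 ?h2 ?h3 ?h4.
by rewrite /c; field; case/and4P: n0 => h1 h2 h3 h4; rewrite ?h1 ?h2 ?h3 ?h4.
Qed.

(* An entry (k, t) lists the coefficients t_k(a), a = 0, ..., q - 1, times the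
   denominator S (24 for q = 4 and 10000 for q = 5); they were found by linear programming. *)
Definition cert4 : seq (nat * seq BinNums.Z) :=
  [:: (1%N, [:: -1; 0; -1; 0]%BZ);
   (2%N, [:: 1; 25; 1; 1]%BZ);
   (3%N, [:: 0; -24; 0; 0]%BZ);
   (6%N, [:: 0; 0; 0; -24]%BZ);
   (10%N, [:: 0; -24; 0; 0]%BZ);
   (30%N, [:: 0; 0; 0; 12]%BZ);
   (40%N, [:: 12; 12; 12; 12]%BZ);
   (120%N, [:: 24; 24; 24; 24]%BZ)].

Definition cert5 : seq (nat * seq BinNums.Z) :=
  [:: (1%N, [:: -156; 0; 0; 0; 0]%BZ);
   (2%N, [:: -1; -1; -1; -1; -1]%BZ);
   (3%N, [:: 0; 10000; 0; 0; 0]%BZ);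
   (4%N, [:: 0; -9999; 1; 1; 1]%BZ);
   (5%N, [:: 156; 156; 156; 156; 156]%BZ);
   (6%N, [:: 0; 1; 1; -9999; 1]%BZ);
   (8%N, [:: 0; 0; 0; 10000; 0]%BZ);
   (9%N, [:: 0; 0; -10000; 0; 0]%BZ);
   (10%N, [:: 1; 0; 1; 1; 1]%BZ);
   (12%N, [:: -1; -1; 9999; -1; -1]%BZ);
   (14%N, [:: 1; 1; 1; 1; 1]%BZ);
   (18%N, [:: 0; 10000; 0; 0; 0]%BZ);
   (21%N, [:: 0; 0; 0; -10000; 0]%BZ);
   (24%N, [:: 0; -9999; 1; 1; 1]%BZ);
   (28%N, [:: 0; 0; 0; 10000; 0]%BZ);
   (30%N, [:: 0; -10000; 0; 0; 0]%BZ);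
   (35%N, [:: 0; 1; -9999; 1; -1563]%BZ);
   (36%N, [:: 1; 0; 1; 0; 1564]%BZ);
   (40%N, [:: 0; 1; 0; 1; 0]%BZ);
   (42%N, [:: 0; -1; -1; -1; 10000]%BZ);
   (45%N, [:: 0; 10000; 0; -10000; -2167]%BZ);
   (56%N, [:: 0; -1; 3274; -1; -17833]%BZ);
   (60%N, [:: -1; -600; -3269; 10002; 2]%BZ);
   (63%N, [:: 1; 10603; -3; 1; 1]%BZ);
   (70%N, [:: 59; 9213; 1562; 8647; -2]%BZ);
   (72%N, [:: 0; -1; -1564; 0; -1]%BZ);
   (75%N, [:: 1; 1; 1; 1; 1]%BZ);
   (84%N, [:: 1; -9215; 0; 1350; 1]%BZ);
   (90%N, [:: -604; -9999; 11884; -9999; 10000]%BZ);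
   (105%N, [:: -13258; -3275; -2; -10000; 9999]%BZ);
   (120%N, [:: -4382; -6729; 4556; 602; -5520]%BZ);
   (126%N, [:: 17404; 10003; -6437; -10603; -3]%BZ);
   (140%N, [:: -3018; 10001; -10000; -7047; 1454]%BZ);
   (150%N, [:: 1; 1; 1; 1; 1]%BZ);
   (168%N, [:: -499; 1; 0; 25940; -10313]%BZ);
   (175%N, [:: 1109; 1109; 1109; 1109; 1109]%BZ);
   (180%N, [:: 4056; -10830; 6268; 8734; 3270]%BZ);
   (200%N, [:: 2; 2; 2; 2; 2]%BZ);
   (210%N, [:: 9221; -18644; -12785; -5163; -2199]%BZ);
   (225%N, [:: 3276; 3276; 3276; 3276; 3276]%BZ);
   (252%N, [:: -13219; 12912; -2346; -10000; -1073]%BZ);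
   (280%N, [:: 20584; 15219; -102; -4911; 8117]%BZ);
   (315%N, [:: 9932; 8515; 5441; -1937; 1112]%BZ);
   (350%N, [:: -4644; -4644; -4644; -4644; -4644]%BZ);
   (360%N, [:: 8328; -7625; 5896; 112; -6399]%BZ);
   (420%N, [:: 12621; 5776; 1669; 9145; 15510]%BZ)].

(** Here c = 356 / (24 * 120) is about 0.124, against a loss 2 q (s / S) / Y = 8 / 120, about
    0.067. *)
Lemma cert4_ok : certificate_ok 4 cert4 24%BZ 24%BZ 2 3 120 120 2 12 356%BZ.
Proof. by vm_compute. Qed.

(** Here c is about 0.0347, against a loss 10 * 1.7612 / 1250, about 0.0141. *)
Lemma cert5_ok : certificate_ok 5 cert5 10000%BZ 17612%BZ 3 4 1250 (63 * 200)%N 4 13 4373902%BZ.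
Proof. by vm_compute. Qed.

(** * Trial division and chains of primes *)

Definition dividesN (d p : BinNums.N) : bool :=
  BinNat.N.eqb (BinNat.N.modulo p d) BinNums.N0.

(** The candidates are d and d + 2 with d = 5 mod 6. Exhausted fuel counts as failure, so success is
    always conclusive. *)
Fixpoint no_divisor (fuel : nat) (d p : BinNums.N) : bool :=
  if fuel is fuel'.+1 then
    if BinNat.N.ltb p (BinNat.N.mul d d) then true
    else if dividesN d p then false
    else if dividesN (BinNat.N.add d 2%BN) p then false
    else no_divisor fuel' (BinNat.N.add d 6%BN) p
  else false.

(** 2500 steps of length 6 go up to d about 15000, beyond the square root of every entry of the
    chains. *)
Definition primeN (p : BinNums.N) : bool :=
  [&& BinNat.N.ltb 1%BN p, ~~ dividesN 2%BN p, ~~ dividesN 3%BN p & no_divisor (50 * 50)%N 5%BN p].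

Lemma dividesNE d p : (0 < BinNat.N.to_nat d)%N ->
  dividesN d p = (BinNat.N.to_nat d %| BinNat.N.to_nat p)%N.
Proof.
move=> d0; rewrite /dvdn -(N_to_nat_div_mod p d0).2 /dividesN.
by apply/BinNat.N.eqb_spec/eqP; lia.
Qed.

Lemma no_divisorP fuel d p : no_divisor fuel d p -> (BinNat.N.to_nat d %% 6 = 5)%N ->
  forall e, (BinNat.N.to_nat d <= e)%N -> (e %% 6 == 1)%N || (e %% 6 == 5)%N ->
    (e ^ 2 <= BinNat.N.to_nat p)%N -> ~~ (e %| BinNat.N.to_nat p)%N.
Proof.
elim: fuel d => // fuel IH d /=; case: BinNat.N.ltb_spec => [hlt _ _ e de _ ep|_].
  have : (BinNat.N.to_nat d * BinNat.N.to_nat d <= e * e)%N by rewrite leq_mul.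
  by rewrite mulnn => h; have := leq_trans h ep; clear - hlt; nia.
case: (boolP (dividesN d p)) => // h1; case: (boolP (dividesN (BinNat.N.add d _) p)) => // h2.
move=> /IH h d5 e de e6 ep.
have d2 : BinNat.N.to_nat (BinNat.N.add d 2%BN) = (BinNat.N.to_nat d + 2)%N by lia.
have d6 : BinNat.N.to_nat (BinNat.N.add d 6%BN) = (BinNat.N.to_nat d + 6)%N by lia.
have [ed|ne1] := eqVneq (BinNat.N.to_nat d) e; first by rewrite -ed -dividesNE //; lia.
have [ed|ne2] := eqVneq (BinNat.N.to_nat d + 2)%N e; first by rewrite -ed -d2 -dividesNE //; lia.
by apply: h => //; rewrite d6; lia.
Qed.

Lemma primeNP p : primeN p -> prime (BinNat.N.to_nat p).
Proof.
case/and4P=> p1; rewrite !dividesNE // -[BinNat.N.to_nat 2%BN]/2%N -[BinNat.N.to_nat 3%BN]/3%N.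
move=> h2 h3 /no_divisorP h.
have p1' : (1 < BinNat.N.to_nat p)%N by lia.
apply: ltn_pdiv2_prime; first by lia.
rewrite ltnNge; apply/negP => le2.
set e := pdiv (BinNat.N.to_nat p) in le2; have pe : prime e := pdiv_prime p1'.
have ep : (e %| BinNat.N.to_nat p)%N := pdiv_dvd _.
have e2 : (e == 2%N) = false.
  by apply/negbTE; apply: contra h2 => /eqP <-.
have e3 : (e == 3%N) = false.
  by apply/negbTE; apply: contra h3 => /eqP <-.
have n2 : ~~ (2 %| e)%N by rewrite dvdn_prime2 // eq_sym e2.
have n3 : ~~ (3 %| e)%N by rewrite dvdn_prime2 // eq_sym e3.
have e1 := prime_gt1 pe.
have := h erefl e _ _ le2; rewrite ep /= => hF.
by apply/notF/hF; clear - e1 n2 n3 e2 e3; lia.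
Qed.

Fixpoint prime_chain (q r u v a top : BinNums.N) (l : seq BinNums.N) : bool :=
  if l is p :: l' then
    [&& BinNat.N.leb (BinNat.N.mul u p) (BinNat.N.mul v a), BinNat.N.eqb (BinNat.N.modulo p q) r,
        primeN p & prime_chain q r u v p top l']
  else BinNat.N.leb top a.

(** The first entry p above B works: its predecessor a is at most B, so u p <= v a <= v B. *)
Lemma prime_chainP q r u v top l a B : prime_chain q r u v a top l ->
  (0 < BinNat.N.to_nat q)%N ->
  (BinNat.N.to_nat a <= B)%N -> (B < BinNat.N.to_nat top)%N ->
  exists p, [/\ prime p, (p %% BinNat.N.to_nat q = BinNat.N.to_nat r)%N, (B < p)%N
    & (BinNat.N.to_nat u * p <= BinNat.N.to_nat v * B)%N].
Proof.
move=> + q0; elim: l a => [|p l IH] a /=; first by lia.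
case/and4P=> up pr pp hl aB Btop.
have [Bp|pB] := ltnP B (BinNat.N.to_nat p); last exact: (IH p).
exists (BinNat.N.to_nat p); split=> //; first exact: primeNP.
  by rewrite -(N_to_nat_div_mod p q0).2; lia.
apply: (@leq_trans (BinNat.N.to_nat v * BinNat.N.to_nat a)); first by lia.
by rewrite leq_mul2l aB orbT.
Qed.

Definition chain4_1 : seq BinNums.N :=
  [:: 197; 293; 433; 641; 953; 1429; 2141; 3209; 4813; 7213; 10789; 16141; 24197; 36293;
    54437; 81649; 122453; 183661; 275489; 413233; 619849; 929749; 1394573; 2091809; 3137681;
    4706521; 7059761; 10589633; 15884357]%BN.

(** 11184811 is the least B with 2 * 4^12 <= 3 B, where [cert4] takes over. *)
Lemma chain4_1_ok : prime_chain 4%BN 1%BN 2%BN 3%BN 140%BN 11184811%BN chain4_1.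
Proof. by vm_compute. Qed.

Definition chain4_3 : seq BinNums.N :=
  [:: 199; 283; 419; 619; 919; 1367; 2039; 3023; 4523; 6779; 10163; 15227; 22811; 34211;
    51307; 76943; 115399; 173087; 259627; 389399; 584063; 876079; 1314043; 1971023; 2956531;
    4434691; 6652031; 9977999; 14966983]%BN.

Lemma chain4_3_ok : prime_chain 4%BN 3%BN 2%BN 3%BN 140%BN 11184811%BN chain4_3.
Proof. by vm_compute. Qed.

Definition chain5_1 : seq BinNums.N :=
  [:: 181; 241; 311; 401; 521; 691; 911; 1201; 1601; 2131; 2801; 3701; 4931; 6571; 8761;
    11681; 15551; 20731; 27631; 36821; 49081; 65381; 87151; 116201; 154871; 206461; 275251;
    367001; 489241; 652321; 869551; 1159381; 1545811; 2061041; 2748041; 3663971; 4885201;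
    6513581; 8684771; 11579681; 15439561; 20586061; 27448021; 36597331; 48796441; 65061911]%BN.

(** 50331648 is the least B with 3 * 4^13 <= 4 B, where [cert5] takes over. *)
Lemma chain5_1_ok : prime_chain 5%BN 1%BN 3%BN 4%BN 140%BN 50331648%BN chain5_1.
Proof. by vm_compute. Qed.

Definition chain5_2 : seq BinNums.N :=
  [:: 167; 197; 257; 337; 397; 487; 647; 857; 1117; 1487; 1907; 2477; 3257; 4337; 5737; 7607;
    10067; 13417; 17837; 23767; 31687; 42227; 56267; 75017; 99907; 133187; 177487; 236627;
    315467; 420557; 560737; 747647; 996857; 1329127; 1772167; 2362817; 3150397; 4200527;
    5600657; 7467487; 9956587; 13275377; 17700427; 23600477; 31467167; 41956157; 55941367]%BN.

Lemma chain5_2_ok : prime_chain 5%BN 2%BN 3%BN 4%BN 140%BN 50331648%BN chain5_2.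
Proof. by vm_compute. Qed.

Definition chain5_3 : seq BinNums.N :=
  [:: 173; 223; 293; 383; 503; 653; 863; 1123; 1493; 1973; 2593; 3433; 4523; 5953; 7933;
    10513; 13963; 18593; 24763; 33013; 43973; 58613; 77983; 103963; 138563; 184733; 246223;
    328283; 437693; 583543; 778013; 1037303; 1383043; 1844033; 2458663; 3278173; 4370813;
    5827643; 7770163; 10360193; 13813463; 18417863; 24557033; 32742683; 43656883; 58209083]%BN.

Lemma chain5_3_ok : prime_chain 5%BN 3%BN 3%BN 4%BN 140%BN 50331648%BN chain5_3.
Proof. by vm_compute. Qed.

Definition chain5_4 : seq BinNums.N :=
  [:: 179; 229; 269; 349; 449; 569; 739; 929; 1229; 1619; 2129; 2819; 3739; 4969; 6619; 8819;
    11719; 15619; 20809; 27739; 36979; 49279; 65699; 87589; 116719; 155609; 207469; 276599;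
    368789; 491669; 655489; 873979; 1165279; 1553509; 2071339; 2761729; 3682229; 4909609;
    6546119; 8728129; 11637389; 15516499; 20688659; 27584839; 36779779; 49039699; 65386159]%BN.

Lemma chain5_4_ok : prime_chain 5%BN 4%BN 3%BN 4%BN 140%BN 50331648%BN chain5_4.
Proof. by vm_compute. Qed.

(** * Collisions modulo m *)

Definition collides (al d : nat) (r : int) (n m : nat) : Prop :=
  exists i j : nat, [/\ (0 < i)%N, (i < j)%N, (j <= n)%N &
    (m%:Z %| al%:Z * (j%:Z - i%:Z) * (d%:Z * (i%:Z + j%:Z) - r))%Z].

Lemma collides_mono al d r n n' m : (n <= n')%N -> collides al d r n m -> collides al d r n' m.
Proof. by move=> nn' [i [j [h1 h2 h3 h4]]]; exists i, j; split=> //; apply: leq_trans nn'. Qed.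

Lemma collides_mulr al be d r n m : collides al d r n m -> collides (be * al) d r n (be * m).
Proof.
case=> i [j [h1 h2 h3 /dvdzP[c h4]]]; exists i, j; split=> //.
by apply/dvdzP; exists c; rewrite !PoszM -!mulrA (mulrA _ _ (_ - r)) h4; ring.
Qed.

Lemma collides_mull al be d r n m : collides al d r n m -> collides (be * al) d r n m.
Proof.
case=> i [j [h1 h2 h3 /dvdzP[c h4]]]; exists i, j; split=> //.
by apply/dvdzP; exists (be%:Z * c); rewrite !PoszM -!mulrA (mulrA _ _ (_ - r)) h4; ring.
Qed.

Lemma collides_lt d r n m : (0 < m < n)%N -> collides 1 d r n m.
Proof.
case/andP=> m0 mn; exists 1%N, m.+1; split=> //.
by rewrite mul1r (_ : _ - _ = m%:Z) ?dvdz_mulr //; lia.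
Qed.

Lemma pair_sum n s : (3 <= s < 2 * n)%N ->
  exists i j, [/\ (0 < i)%N, (i < j)%N, (j <= n)%N & (i + j = s)%N].
Proof.
move=> hs; case: (boolP (odd s)) => os.
  by exists s./2, s./2.+1; split; lia.
by exists s./2.-1, s./2.+1; split; lia.
Qed.

Lemma collides_sum d r n m s c : (3 <= s < 2 * n)%N ->
  d%:Z * s%:Z - r = c * m%:Z -> collides 1 d r n m.
Proof.
move=> /pair_sum[i [j [i0 ij jn e]]] h; exists i, j; split=> //.
by rewrite -PoszD e h mul1r mulrA dvdz_mull.
Qed.

(** The factor b divides d (i + j) - r, and 3 divides j - i, which is chosen as 3 or 6 according to
    the parity of s = i + j. *)
Lemma collides_factor3 d r n b s c : (8 <= s)%N -> (s + 6 <= 2 * n)%N ->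
  d%:Z * s%:Z - r = c * b%:Z -> collides 1 d r n (3 * b).
Proof.
move=> s8 sn h.
have [i [j [i0 ij jn e [x ex]]]] : exists i j, [/\ (0 < i)%N, (i < j)%N, (j <= n)%N,
    (i + j = s)%N & exists x : int, j%:Z - i%:Z = x * 3].
  case: (boolP (odd s)) => os.
    by exists (s - 3)./2, (s + 3)./2; split; try lia; exists 1; lia.
  by exists (s - 6)./2, (s + 6)./2; split; try lia; exists 2; lia.
exists i, j; split=> //; rewrite -PoszD e h ex mul1r PoszM.
by apply/dvdzP; exists (x * c); ring.
Qed.

(** With j = i + a the last factor is 2 d i + (d a - r). As 2 d is a unit modulo b, some i in [1, b]
    makes it divisible by b, and then j <= a + b <= n. *)
Lemma collides_factor d r n a b : (0 < a)%N -> (0 < b)%N -> coprime b (2 * d) ->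
  (a + b <= n)%N -> r <= (d * a)%:Z -> collides 1 d r n (a * b).
Proof.
move=> a0 b0 bd abn rda.
pose X := `|(d * a)%:Z - r|%N.
have [i hi hX] : exists2 i, (0 < i <= b)%N & (b %| i * (2 * d) + X)%N.
  (* X (b - 1) represents -X modulo b as a natural number. *)
  have [i hi e] := exists_residue (X * b.-1)%N 0 b0 bd; exists i => //.
  by rewrite /dvdn -modnDml (eqP e) modnDml -mulnSr prednK // modnMl.
exists i, (i + a)%N; split; [lia|lia|lia|].
have eX : (d * a)%:Z - r = X%:Z by rewrite /X; lia.
have /dvdnP[c hc] := hX.
apply/dvdzP; exists c%:Z.
have -> : d%:Z * (i%:Z + (i + a)%N%:Z) - r = (i * (2 * d) + X)%N%:Z.
  by rewrite !PoszD -eX !PoszM; ring.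
by rewrite hc !PoszD !PoszM; ring.
Qed.

Lemma composite_factors m : (1 < m)%N -> ~~ prime m ->
  exists a b, [/\ m = (a * b)%N, prime a & (a <= b)%N].
Proof.
move=> m1 mp; exists (pdiv m), (m %/ pdiv m)%N.
have e : m = (pdiv m * (m %/ pdiv m))%N by rewrite mulnC divnK ?pdiv_dvd.
split=> //; first exact: pdiv_prime.
rewrite leqNgt; apply/negP => h; case/negP: mp; apply: ltn_pdiv2_prime; first by lia.
by rewrite {1}e -mulnn ltn_pmul2l // pdiv_gt0.
Qed.

(** This is (a - c)(b - c) >= 0; it bounds a + b by about a b / c. *)
Lemma mul_add_le c a b : (c <= a)%N -> (c <= b)%N -> (c * (a + b) <= a * b + c * c)%N.
Proof. by move=> ca cb; rewrite -(subnKC ca) -(subnKC cb); nia. Qed.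

(** If m = -r mod 4, then 4 s - r = m is solvable; if m = r, then 4 s - r = 3 m is, with s < 2 n
    when 3 m < 8 n - r. Otherwise m = a b is composite with a its least prime factor: for a >= 5 the
    sum a + b is at most n, and a = 3 is treated apart. *)
Lemma collides4_odd n m r : (60 <= n)%N -> r = 1 \/ r = -1 -> odd m -> (m < 4 * n)%N ->
  (prime m -> (4 %| m%:Z - r)%Z -> 8 * n%:Z - r <= 3 * m%:Z -> False) -> collides 1 4 r n m.
Proof.
move=> n60 hr om mn hp.
have [mn'|nm] := ltnP m n; first by apply: collides_lt; lia.
have [mr|mr] := boolP (4 %| m%:Z + r)%Z.
  case/dvdzP: mr => c hc.
  by apply: (@collides_sum 4 r n m `|c|%N 1); case: hr; lia.
have {}mr : (4 %| m%:Z - r)%Z by case: hr; lia.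
have [m3|m3] := ltP (3 * m%:Z) (8 * n%:Z - r).
  have : (4 %| 3 * m%:Z + r)%Z by case: hr; lia.
  case/dvdzP=> c hc.
  by apply: (@collides_sum 4 r n m `|c|%N 3); case: hr; lia.
have mp : ~~ prime m by apply/negP => pm; apply: hp.
have m1 : (1 < m)%N by lia.
have [a [b [eab pa ab]]] := composite_factors m1 mp.
have [oa ob] : odd a /\ odd b by move: om; rewrite eab oddM => /andP[].
have a2 := prime_gt1 pa.
have [a5|a5] := leqP 5 a.
  have hab := mul_add_le a5 (leq_trans a5 ab); rewrite -eab in hab.
  have hr1 : r <= 1 by clear - hr; case: hr => ->.
  rewrite eab; apply: collides_factor; [| | | |].
  - by clear - a5; lia.
  - by clear - a5 ab; lia.
  2: by clear - n60 hab mn; lia.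
  2: by clear - hr1 a5; lia.
  by rewrite -[(2 * 4)%N]/(2 ^ 3)%N coprimeXr // coprimen2.
have a3 : a = 3%N by lia.
rewrite a3 in eab; rewrite eab; clear - n60 hr mr m3 mn nm eab.
(* 3 b = r mod 4 gives b = -r, so 4 s - r = b is solvable. *)
have : (4 %| b%:Z + r)%Z by case: hr; lia.
case/dvdzP=> c hc.
by apply: (@collides_factor3 4 r n b `|c|%N 1); case: hr; lia.
Qed.

(** The factor 4 of f absorbs a factor 2 or 4 of m, leaving an odd modulus or one smaller than n. *)
Lemma collides4 n m r : (60 <= n)%N -> r = 1 \/ r = -1 -> (0 < m < 4 * n)%N ->
  (forall m', (m' <= m)%N ->
     prime m' -> (4 %| m'%:Z - r)%Z -> 8 * n%:Z - r <= 3 * m'%:Z -> False) ->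
  collides 4 4 r n m.
Proof.
move=> n60 hr /andP[m0 mn] hp.
have [om|em] := boolP (odd m).
  by apply: (@collides_mull 1 4); apply: collides4_odd => //; apply: hp.
have em2 : m = (2 * m./2)%N by lia.
have [om2|em2'] := boolP (odd m./2).
  rewrite em2 -[4%N]/(2 * 2)%N; apply: collides_mulr; apply: (@collides_mull 1 2).
  by apply: collides4_odd => //; [lia|apply: hp; lia].
have {}em2 : m = (4 * (m./2)./2)%N by lia.
by rewrite em2; apply: (@collides_mulr 1 4); apply: collides_lt; lia.
Qed.

(** For m prime to 5 and different from r mod 5, some t in {1, 2, 3} has t m = -r mod 5, and 3 m <
    10 n - r makes s small enough. For m = r mod 5 one needs t = 4, and when 4 m is too large a
    factorisation m = a b with a >= 7 or a = 3. *)
Lemma collides5_coprime n m (r : int) : (60 <= n)%N -> r \in [:: 1; -1; 2; -2] ->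
  ~~ (5 %| m)%N -> (n <= 2 * m)%N -> 3 * m%:Z < 10 * n%:Z - r ->
  (odd m -> ~~ prime m \/ 4 * m%:Z < 10 * n%:Z - r \/ ~~ (5 %| m%:Z - r)%Z) ->
  (~~ odd m -> 4 * m%:Z < 10 * n%:Z - r) -> collides 1 5 r n m.
Proof.
move=> n60; rewrite !inE => hr m5 nm m3 ho he.
have hr' : [\/ r = 1, r = -1, r = 2 | r = -2].
  by case/or4P: hr => /eqP->; [apply: Or41|apply: Or42|apply: Or43|apply: Or44].
have hsum t : (0 < t)%N -> (5 %| t%:Z * m%:Z + r)%Z -> t%:Z * m%:Z < 10 * n%:Z - r ->
    collides 1 5 r n m.
  move=> t0 /dvdzP[c hc] hlt; have tm : (m <= t * m)%N by rewrite leq_pmull.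
  apply: (@collides_sum 5 r n m `|c|%N t%:Z); last by clear - hr' hc tm nm n60; case: hr'; lia.
  by clear - hr' hc tm nm n60 hlt; case: hr'; lia.
have [m4|m4] := boolP (5 %| m%:Z - r)%Z; last first.
  have : [\/ (5 %| 1%:Z * m%:Z + r)%Z, (5 %| 2%:Z * m%:Z + r)%Z | (5 %| 3%:Z * m%:Z + r)%Z].
    have h5 : [\/ m %% 5 = 1, m %% 5 = 2, m %% 5 = 3 | m %% 5 = 4]%N.
      clear - m5; case: (ltnP (m %% 5) 2) => h2; first by apply: Or41; lia.
      case: (ltnP (m %% 5) 3) => h3; first by apply: Or42; lia.
      by case: (ltnP (m %% 5) 4) => h4; [apply: Or43|apply: Or44]; lia.
    clear - hr' h5 m4; case: hr' m4 => -> m4; case: h5 => e;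
      first [by exfalso; lia | by apply: Or31; lia | by apply: Or32; lia | by apply: Or33; lia].
  by case=> h; apply: hsum h _ => //; lia.
have [lt4|ge4] := ltP (4 * m%:Z) (10 * n%:Z - r).
  by apply: (hsum 4%N) => //; lia.
have om : odd m by apply/negPn/negP => /he; lia.
have mp : ~~ prime m by case: (ho om) => [//|[|]]; lia.
have m1 : (1 < m)%N by lia.
have [a [b [eab pa ab]]] := composite_factors m1 mp.
have [oa ob] : odd a /\ odd b by move: om; rewrite eab oddM => /andP[].
have a2 := prime_gt1 pa.
have [a7|a7] := leqP 7 a.
  have hab := mul_add_le a7 (leq_trans a7 ab); rewrite -eab in hab.
  have hr1 : r <= 2 by clear - hr'; case: hr' => ->.
  have b5 : ~~ (5 %| b)%N by apply: contra m5; rewrite eab; apply: dvdn_mull.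
  rewrite eab; apply: collides_factor; [| | | |].
  - by clear - a7; lia.
  - by clear - a7 ab; lia.
  - by rewrite -[(2 * 5)%N]/(2 * 5)%N coprimeMr coprimen2 ob coprime_sym prime_coprime.
  - by clear - n60 hab m3 hr'; case: hr'; lia.
  by clear - hr1 a7; lia.
have a3 : a = 3%N.
  have : a != 5%N by apply: contraNneq m5 => a5; rewrite eab a5 dvdn_mulr.
  by clear - a7 oa a2; lia.
rewrite a3 in eab; rewrite eab; clear - n60 hr' m4 m3 ge4 eab.
(* 3 b = r mod 5 gives b = 2 r, hence 2 b = -r. *)
have : (5 %| 2 * b%:Z + r)%Z by case: hr'; lia.
case/dvdzP=> c hc.
by apply: (@collides_factor3 5 r n b `|c|%N 2); case: hr'; lia.
Qed.

(** The factor 10 of f absorbs a factor 5 or 2 of m. In the even case m / 2 is so small that t = 4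
    is available, so no primality condition arises. *)
Lemma collides5 n m (r : int) : (60 <= n)%N -> r \in [:: 1; -1; 2; -2] ->
  (0 < m)%N -> 3 * m%:Z < 10 * n%:Z - r ->
  (prime m -> (5 %| m%:Z - r)%Z -> 10 * n%:Z - r <= 4 * m%:Z -> False) ->
  collides 10 5 r n m.
Proof.
move=> n60 hr m0 m3 hp.
have hr2 : r <= 2 /\ -2 <= r.
  by move: hr; rewrite !inE => /or4P[] /eqP->.
have [mn'|nm] := ltnP m n; first by apply: (@collides_mull 1 10); apply: collides_lt; lia.
have [m5|m5] := boolP (5 %| m)%N.
  have {}m5 : m = (5 * (m %/ 5))%N by lia.
  rewrite m5; apply: (@collides_mulr 2 5); apply: (@collides_mull 1 2); apply: collides_lt.
  by clear - m5 m0 m3 hr2 n60; lia.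
have [om|em] := boolP (odd m).
  apply: (@collides_mull 1 10); apply: collides5_coprime => //; [by lia| |].
    move=> _; case: (boolP (prime m)) => [pm|]; last by left.
    right; case: (boolP (5 %| m%:Z - r)%Z) => [mr|]; last by right.
    by left; rewrite ltNge; apply/negP; apply: hp.
  by rewrite om.
have em2 : m = (2 * m./2)%N by lia.
rewrite em2; apply: (@collides_mulr 5 2); apply: (@collides_mull 1 5).
have h4 : 4 * m./2%:Z < 10 * n%:Z - r by clear - em2 m3; lia.
apply: collides5_coprime => //; [|lia|lia|].
  by apply: contra m5 => h; rewrite em2 dvdn_mull.
by move=> _; right; left.
Qed.

Lemma is_least_modulus_collides (f : nat -> int) al d r n p :
  (forall k, f k = al%:Z * k%:Z * (d%:Z * k%:Z - r)) -> (0 < p)%N ->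
  ~ collides al d r n p -> (forall m, (0 < m < p)%N -> collides al d r n m) ->
  is_least_modulus f n p.
Proof.
move=> fE p0 hp hm.
have fB i j : f j - f i = al%:Z * (j%:Z - i%:Z) * (d%:Z * (i%:Z + j%:Z) - r).
  by rewrite !fE; ring.
split; last first.
  move=> m [m0 dist]; rewrite leqNgt; apply/negP => mp.
  have [|i [j [i0 ij jn h]]] := hm m; first by rewrite m0.
  apply: (dist j i); [lia|lia|lia|].
  by apply/eqP; rewrite eqz_mod_dvd fB.
split=> // i j hi hj ij /eqP; rewrite eqz_mod_dvd => h.
have [lt_ij|lt_ji|//] := ltngtP i j; apply: hp.
  by exists i, j; split; [lia|lia|lia|rewrite -fB -opprB rpredN].
by exists j, i; split; [lia|lia|lia|rewrite -fB].
Qed.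

Lemma is_least_primeP r d b p (N c : int) :
  (forall q : nat, (b <= q%:R) = (N <= c * q%:Z)) ->
  [/\ prime p, (d%:Z %| p%:Z - r)%Z & N <= c * p%:Z] ->
  (forall q, prime q -> (d%:Z %| q%:Z - r)%Z -> N <= c * q%:Z -> (p <= q)%N) ->
  is_least_prime r d b p.
Proof.
move=> hb [pp pr pN] hmin; split; first by split=> //; [apply/eqP; rewrite eqz_mod_dvd|rewrite hb].
by move=> q [qp /eqP]; rewrite eqz_mod_dvd hb; apply: hmin.
Qed.

Lemma not_collides al d n p (r : int) : prime p -> (al < p)%N -> (0 < al)%N -> (n <= p)%N ->
  (forall (s : nat) (c : int), (2 < s)%N -> d%:Z * s%:Z - r = c * p%:Z -> (2 * n <= s)%N) ->
  ~ collides al d r n p.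
Proof.
move=> pp alp al0 np h [i [j [i0 ij jn]]].
rewrite dvdzE !abszM !Euclid_dvdM // -orbA => /or3P[/dvdn_leq|/dvdn_leq|hs].
- by lia.
- by lia.
have /dvdzP[c hc] : (p%:Z %| d%:Z * (i%:Z + j%:Z) - r)%Z by rewrite dvdzE.
have := h (i + j)%N c; rewrite PoszD hc => /(_ _ erefl); lia.
Qed.

Lemma not_collides4 n p (r : int) : (6 <= n)%N -> r = 1 \/ r = -1 -> prime p ->
  (4 %| p%:Z - r)%Z -> 8 * n%:Z - r <= 3 * p%:Z -> ~ collides 4 4 r n p.
Proof.
move=> n6 hr pp /dvdzP[e he] hp; apply: not_collides => //; [|  |].
- by clear - n6 hr hp; case: hr; lia.
- by clear - n6 hr hp; case: hr; lia.
move=> s c s3 hc.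
have c0 : 0 < c.
  rewrite -(pmulr_lgt0 c (_ : 0 < p%:Z)); clear - hr hc s3 pp; last by have := prime_gt0 pp; lia.
  by case: hr; lia.
have hce : c * p%:Z = 4 * (c * e) + c * r by rewrite -(subrK r p%:Z) he; ring.
(* Modulo 4 the equation 4 s - r = c p reads -r = c r, so c = -1. *)
have c3 : 3 <= c by clear - c0 hce hc hr; case: hr hce hc => ->; lia.
have := ler_wpM2r (_ : 0 <= p%:Z) c3; rewrite -hc.
by clear - hp hr => /(_ isT); case: hr hp => ->; lia.
Qed.

Lemma not_collides5 n p (r : int) : (5 <= n)%N -> r \in [:: 1; -1; 2; -2] -> prime p ->
  (5 %| p%:Z - r)%Z -> 10 * n%:Z - r <= 4 * p%:Z -> ~ collides 10 5 r n p.
Proof.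
move=> n5 hr0 pp /dvdzP[e he] hp.
have hr : [\/ r = 1, r = -1, r = 2 | r = -2].
  by move: hr0; rewrite !inE => /or4P[]/eqP->; [apply: Or41|apply: Or42|apply: Or43|apply: Or44].
apply: not_collides => //; [|  |].
- by clear - n5 hr hp; case: hr; lia.
- by clear - n5 hr hp; case: hr; lia.
move=> s c s3 hc.
have c0 : 0 < c.
  rewrite -(pmulr_lgt0 c (_ : 0 < p%:Z)); clear - hr hc s3 pp; last by have := prime_gt0 pp; lia.
  by case: hr; lia.
have hce : c * p%:Z = 5 * (c * e) + c * r by rewrite -(subrK r p%:Z) he; ring.
have c3 : 4 <= c by clear - c0 hce hc hr; case: hr hce hc => ->; lia.
have := ler_wpM2r (_ : 0 <= p%:Z) c3; rewrite -hc.
by clear - hp hr => /(_ isT); case: hr hp => ->; lia.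
Qed.

(** * Primes of a given class in (B, 3B/2] modulo 4 and in (B, 4B/3] modulo 5 *)

Lemma Rln_mul (x y : Rdefinitions.R) : 0 < x -> 0 < y ->
  Rpower.ln (x * y) = Rpower.ln x + Rpower.ln y.
Proof. by move=> /RltP x0 /RltP y0; apply: Rpower.ln_mult. Qed.

Lemma Rln_le_subr1 (x : Rdefinitions.R) : 0 < x -> Rpower.ln x <= x - 1.
Proof.
move=> /RltP x0; have /RleP := Rpower.exp_ineq1_le (Rpower.ln x).
by rewrite Rpower.exp_ln // RplusE R1E; lra.
Qed.

Lemma exists_prime_mod4 r B : r \in [:: 1; 3]%N -> (140 <= B)%N ->
  exists p, [/\ prime p, (p %% 4 = r)%N, (B < p)%N & (2 * p <= 3 * B)%N].
Proof.
move=> hr B140.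
have [Bt|tB] := ltnP B (BinNat.N.to_nat 11184811%BN).
  move: hr; rewrite !inE => /orP[]/eqP->.
    by apply: (prime_chainP chain4_1_ok).
  by apply: (prime_chainP chain4_3_ok).
(* The certificate yields p = 1 / r, and a unit modulo 4 is its own inverse. *)
have [p [pp pr Bp hp]] : exists p, [/\ prime p, (p * r == 1 %[mod 4])%N, (B < p)%N & (2 * p <= 3 * B)%N].
  apply: (exists_prime_of_certificate Rln_mul Rln_le_subr1 cert4_ok).
    by move: hr; rewrite !inE => /orP[]/eqP->.
  by clear - tB; lia.
clear tB; exists p; split=> //.
by move: hr pr; rewrite !inE => /orP[]/eqP->; clear; lia.
Qed.

Lemma exists_prime_mod5 r B : r \in [:: 1; 2; 3; 4]%N -> (140 <= B)%N ->
  exists p, [/\ prime p, (p %% 5 = r)%N, (B < p)%N & (3 * p <= 4 * B)%N].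
Proof.
move=> hr B140.
have [Bt|tB] := ltnP B (BinNat.N.to_nat 50331648%BN).
  move: hr; rewrite !inE => /or4P[]/eqP->.
  - by apply: (prime_chainP chain5_1_ok).
  - by apply: (prime_chainP chain5_2_ok).
  - by apply: (prime_chainP chain5_3_ok).
  - by apply: (prime_chainP chain5_4_ok).
(* r^3 is the inverse of r modulo 5. *)
have [p [pp pr Bp hp]] : exists p, [/\ prime p, (p * (r ^ 3) == 1 %[mod 5])%N, (B < p)%N & (3 * p <= 4 * B)%N].
  apply: (exists_prime_of_certificate Rln_mul Rln_le_subr1 cert5_ok).
    by move: hr; rewrite !inE => /or4P[]/eqP->.
  by clear - tB; lia.
clear tB; exists p; split=> //.
by move: hr pr; rewrite !inE => /or4P[]/eqP->; clear; lia.
Qed.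

(** * The least prime of the class as least modulus for n >= 60 *)

Definition is_modulus_prime (al d c : nat) (r : int) (n p : nat) : Prop :=
  [/\ [/\ prime p, (d%:Z %| p%:Z - r)%Z & (2 * d * n)%N%:Z - r <= c%:Z * p%:Z],
      (forall q, prime q -> (d%:Z %| q%:Z - r)%Z -> (2 * d * n)%N%:Z - r <= c%:Z * q%:Z -> (p <= q)%N),
      ~ collides al d r n p & forall m, (0 < m < p)%N -> collides al d r n m].

Definition least_candidate (d c : nat) (r : int) (n p : nat) : bool :=
  [&& prime p, (d%:Z %| p%:Z - r)%Z & (2 * d * n)%N%:Z - r <= c%:Z * p%:Z].

Lemma modulus_prime_large4 n r : (60 <= n)%N -> r = 1 \/ r = -1 ->
  exists p, is_modulus_prime 4 4 3 r n p.
Proof.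
(* B is the largest integer below (8 n - r) / 3, so the primes of the class above B are the
   candidates, and 3 B / 2 is at most 4 n. *)
move=> n60 hr; set B := `|((8 * n%:Z - r - 1) %/ 3)%Z|%N.
have B140 : (140 <= B)%N by clear - n60 hr B; case: hr; lia.
have hB q : (B < q)%N = (8 * n%:Z - r <= 3 * q%:Z) by clear - n60 hr B; case: hr; lia.
have [p0 [pp0 pr0 Bp0 hp0]] : exists p, [/\ prime p, (4 %| p%:Z - r)%Z, (B < p)%N & (2 * p <= 3 * B)%N].
  have [|p [pp pr Bp hp]] := @exists_prime_mod4 (if r == 1 then 1 else 3)%N B _ B140.
    by case: ifP.
  by exists p; split=> //; clear - pr hr; case: hr pr => -> /=; lia.
have ex : exists p, least_candidate 4 3 r n p.
  by exists p0; rewrite /least_candidate pp0 pr0 /= -[(2 * 4)%N]/8%N PoszM -hB.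
have [p /and3P[pp pr hp] pmin] := ex_minnP ex.
have pmin' q : prime q -> (4%:Z %| q%:Z - r)%Z -> (2 * 4 * n)%N%:Z - r <= 3%:Z * q%:Z -> (p <= q)%N.
  by move=> h1 h2 h3; apply: pmin; apply/and3P.
have pp0' : (p <= p0)%N by apply: pmin'; rewrite // -[(2 * 4)%N]/8%N PoszM -hB.
exists p; split=> //.
  by apply: not_collides4 => //; lia.
move=> m /andP[m0 mp]; apply: collides4 => //.
  by rewrite m0; clear - mp pp0' hp0 Bp0 n60 hr B; case: hr; lia.
move=> m' m'm pm' mr' hm'; have := pmin' m' pm' mr'; rewrite PoszM => /(_ hm'); lia.
Qed.

Lemma modulus_prime_large5 n (r : int) : (60 <= n)%N -> r \in [:: 1; -1; 2; -2] ->
  exists p, is_modulus_prime 10 5 4 r n p.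
Proof.
move=> n60 hr0; have hr : [\/ r = 1, r = -1, r = 2 | r = -2].
  by move: hr0; rewrite !inE => /or4P[]/eqP->; [apply: Or41|apply: Or42|apply: Or43|apply: Or44].
(* The largest integer below (10 n - r) / 4; then 4 B / 3 is less than (10 n - r) / 3, as
   [collides5] requires. *)
set B := `|((10 * n%:Z - r - 1) %/ 4)%Z|%N.
have B140 : (140 <= B)%N by clear - n60 hr B; case: hr; lia.
have hB q : (B < q)%N = (10 * n%:Z - r <= 4 * q%:Z) by clear - n60 hr B; case: hr; lia.
have [p0 [pp0 pr0 Bp0 hp0]] : exists p, [/\ prime p, (5 %| p%:Z - r)%Z, (B < p)%N & (3 * p <= 4 * B)%N].
  have [|p [pp pr Bp hp]] := @exists_prime_mod5 `|(r %% 5)%Z|%N B _ B140.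
    by clear - hr; case: hr => ->.
  by exists p; split=> //; clear - pr hr; case: hr pr => ->; lia.
have ex : exists p, least_candidate 5 4 r n p.
  by exists p0; rewrite /least_candidate pp0 pr0 /= -[(2 * 5)%N]/10%N PoszM -hB.
have [p /and3P[pp pr hp] pmin] := ex_minnP ex.
have pmin' q : prime q -> (5%:Z %| q%:Z - r)%Z -> (2 * 5 * n)%N%:Z - r <= 4%:Z * q%:Z -> (p <= q)%N.
  by move=> h1 h2 h3; apply: pmin; apply/and3P.
have pp0' : (p <= p0)%N by apply: pmin'; rewrite // -[(2 * 5)%N]/10%N PoszM -hB.
exists p; split=> //.
  by apply: not_collides5 => //; lia.
move=> m /andP[m0 mp]; apply: collides5 => //.
  by clear - mp pp0' hp0 Bp0 n60 hr B; case: hr; lia.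
move=> pm mr hm; have := pmin' m pm mr; rewrite PoszM => /(_ hm); lia.
Qed.

(** * The cases n < 60 by computation *)

Fixpoint progression_hits (k v e m : nat) : bool :=
  if k is k'.+1 then
    let v' := if (m <= v + e)%N then (v + e - m)%N else (v + e)%N in
    (v' == 0%N) || progression_hits k' v' e m
  else false.

Lemma progression_hitsP k v e m : progression_hits k v e m ->
  exists2 i, (0 < i <= k)%N & (m %| v + i * e)%N.
Proof.
elim: k v => // k IH v /=; set v' := if _ then _ else _.
have hv i : (m %| v' + i * e)%N -> (m %| v + i.+1 * e)%N.
  rewrite /v' mulSn addnA; case: leqP => // h hd.
  by rewrite -(subnK h) addnAC dvdn_addl.
case/orP => [/eqP v0|/IH[i hi hd]]; last by exists i.+1; [lia|apply: hv].
by exists 1%N => //; apply: hv; rewrite v0 mul0n dvdn0.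
Qed.

(* For j = i + x the quantity al (j - i) (d (i + j) - r) is an arithmetic progression in i. *)
Definition zcollides (al d : BinNums.Z) (r : BinNums.Z) (n m : nat) : bool :=
  has (fun x =>
    let z := BinInt.Z.of_nat x in
    let res a := BinInt.Z.to_nat (BinInt.Z.modulo a (BinInt.Z.of_nat m)) in
    let ax := BinInt.Z.mul al z in
    progression_hits (n - x) (res (BinInt.Z.mul ax (BinInt.Z.sub (BinInt.Z.mul d z) r)))
      (res (BinInt.Z.mul ax (BinInt.Z.add d d))) m)
    (iota 1 n.-1).

Lemma zcollidesP al d (r : int) n m : (0 < m)%N ->
  zcollides (BinInt.Z.of_nat al) (BinInt.Z.of_nat d) (Z_of_int r) n m -> collides al d r n m.
Proof.
move=> m0 /hasP[x]; rewrite mem_iota => hx /progression_hitsP[i hi /dvdnP[c hc]].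
exists i, (i + x)%N; split; [lia|lia|lia|].
have resP a : exists b : BinNums.Z, a = BinInt.Z.add (BinInt.Z.mul b (BinInt.Z.of_nat m))
    (BinInt.Z.of_nat (BinInt.Z.to_nat (BinInt.Z.modulo a (BinInt.Z.of_nat m)))).
  exists (BinInt.Z.div a (BinInt.Z.of_nat m)).
  have mz : BinInt.Z.lt BinNums.Z0 (BinInt.Z.of_nat m) by clear - m0; lia.
  have [a0 _] := BinInt.Z.mod_pos_bound a _ mz.
  rewrite Znat.Z2Nat.id // BinInt.Z.mul_comm; apply: BinInt.Z.div_mod; clear - mz; lia.
have [b1 h1] := resP (BinInt.Z.mul (BinInt.Z.mul (BinInt.Z.of_nat al) (BinInt.Z.of_nat x))
   (BinInt.Z.sub (BinInt.Z.mul (BinInt.Z.of_nat d) (BinInt.Z.of_nat x)) (Z_of_int r))).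
have [b2 h2] := resP (BinInt.Z.mul (BinInt.Z.mul (BinInt.Z.of_nat al) (BinInt.Z.of_nat x))
   (BinInt.Z.add (BinInt.Z.of_nat d) (BinInt.Z.of_nat d))).
apply/dvdzP; exists (int_of_Z b1 + i%:Z * int_of_Z b2 + c%:Z).
move: hc h1 h2; set v1 := BinInt.Z.to_nat _; set v2 := BinInt.Z.to_nat _.
clear; move: v1 v2 => v1 v2 hc h1 h2.
have H1 : al%:Z * x%:Z * (d%:Z * x%:Z - r) = int_of_Z b1 * m%:Z + v1%:Z by lia.
have H2 : al%:Z * x%:Z * (d%:Z + d%:Z) = int_of_Z b2 * m%:Z + v2%:Z by lia.
have Hc : c%:Z * m%:Z = v1%:Z + i%:Z * v2%:Z by rewrite -!PoszM -PoszD hc.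
transitivity ((int_of_Z b1 * m%:Z + v1%:Z) + i%:Z * (int_of_Z b2 * m%:Z + v2%:Z)).
  by rewrite -H1 -H2 PoszD; ring.
by rewrite [RHS]mulrDl Hc; ring.
Qed.

(* Both properties checked here persist when n grows, so that for n in [n0, n1]
   only the moduli m >= p0, where p0 belongs to the previous range, need to be examined. *)
Fixpoint small_cases (al d c : nat) (r : int) (n0 p0 : nat) (l : seq (nat * nat)) : bool :=
  if l is (n1, p) :: l' then
    [&& least_candidate d c r n1 p,
      all (fun q => ~~ least_candidate d c r n0 q) (iota p0 (p - p0)),
      all (zcollides (BinInt.Z.of_nat al) (BinInt.Z.of_nat d) (Z_of_int r) n0) (iota p0 (p - p0))
      & small_cases al d c r n1.+1 p l']
  else n0 == 60%N.

Lemma least_candidate_mono d c r k l p : (k <= l)%N ->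
  least_candidate d c r l p -> least_candidate d c r k p.
Proof.
move=> kl /and3P[pp pr hp]; rewrite /least_candidate pp pr /= (le_trans _ hp) //.
by rewrite lerD2r lez_nat leq_mul2l kl orbT.
Qed.

(** Being a candidate passes from n1 down to n, whereas failing to be one and having a collision
    pass from n0 up to n. Testing at the two ends therefore covers the whole range. *)
Lemma small_casesP al d c r n0 p0 l n : small_cases al d c r n0 p0 l ->
  (forall p, prime p -> (d%:Z %| p%:Z - r)%Z -> (2 * d * n)%N%:Z - r <= c%:Z * p%:Z ->
     ~ collides al d r n p) ->
  (n0 <= n < 60)%N ->
  (forall q, (q < p0)%N -> ~~ least_candidate d c r n q) ->
  (forall m, (0 < m < p0)%N -> collides al d r n m) ->
  exists p, is_modulus_prime al d c r n p.
Proof.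
move=> + nc; elim: l n0 p0 => [|[n1 p] l IH] n0 p0 /=; first by move=> /eqP->; lia.
case/and4P=> hp /allP hq /allP hm hl /andP[n0n n60] hq0 hm0.
have {}hq q : (q < p)%N -> ~~ least_candidate d c r n q.
  move=> qp; have [/hq0//|p0q] := ltnP q p0.
  have /hq : q \in iota p0 (p - p0) by rewrite mem_iota; lia.
  by apply: contra; apply: least_candidate_mono.
have {}hm m : (0 < m < p)%N -> collides al d r n m.
  move=> /andP[m0 mp]; have [mp0|p0m] := ltnP m p0; first by apply: hm0; rewrite m0.
  apply: (collides_mono n0n); apply: zcollidesP => //; apply: hm.
  by rewrite mem_iota; lia.
have [nn1|n1n] := leqP n n1; last by apply: (IH n1.+1 p) => //; rewrite n1n.
have /and3P[pp pr hp'] := least_candidate_mono nn1 hp.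
exists p; split=> //; last exact: nc.
move=> q pq qr hq'; rewrite leqNgt; apply/negP => /hq /negP; apply.
by apply/and3P.
Qed.

Lemma modulus_prime4 n (r : int) : (6 <= n)%N -> r = 1 \/ r = -1 ->
  exists p, is_modulus_prime 4 4 3 r n p.
Proof.
move=> n6 hr; have [n60|n60] := ltnP n 60; last exact: modulus_prime_large4.
have nc p : prime p -> (4%:Z %| p%:Z - r)%Z -> (2 * 4 * n)%N%:Z - r <= 3%:Z * p%:Z ->
    ~ collides 4 4 r n p.
  by rewrite PoszM => *; apply: not_collides4.
have hn : (6 <= n < 60)%N by rewrite n6.
case: hr nc => -> nc.
  (* A pair (n1, p) states that p is the answer for all n up to n1 that exceed the first entry of
     the preceding pair. *)
  apply: (@small_casesP 4 4 3 1 6 1 [:: (6, 17); (11, 29); (14, 37); (15, 41); (20, 53);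
    (23, 61); (27, 73); (33, 89); (36, 97); (38, 101); (41, 109); (42, 113); (51, 137);
    (56, 149); (59, 157)]%N n _ nc hn _ _);
    [|by case|by case=> [|m] /andP[]].
  by vm_compute.
apply: (@small_casesP 4 4 3 (-1) 6 1 [:: (7, 19); (8, 23); (11, 31); (16, 43); (17, 47);
  (22, 59); (25, 67); (26, 71); (29, 79); (31, 83); (38, 103); (40, 107); (47, 127);
  (49, 131); (52, 139); (56, 151); (59, 163)]%N n _ nc hn _ _);
    [|by case|by case=> [|m] /andP[]].
by vm_compute.
Qed.

Lemma modulus_prime5 n (r : int) : r \in [:: 1; -1; 2; -2] -> (Cbound r <= n)%N ->
  exists p, is_modulus_prime 10 5 4 r n p.
Proof.
move=> hr Cn; have [n60|n60] := ltnP n 60; last exact: modulus_prime_large5.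
have n5 : (5 <= n)%N by apply: leq_trans Cn; move: hr; rewrite !inE => /or4P[]/eqP->.
have nc p : prime p -> (5%:Z %| p%:Z - r)%Z -> (2 * 5 * n)%N%:Z - r <= 4%:Z * p%:Z ->
    ~ collides 10 5 r n p.
  by rewrite PoszM => *; apply: not_collides5.
have hn : (Cbound r <= n < 60)%N by rewrite Cn.
move: hr nc hn; rewrite !inE => /or4P[]/eqP-> nc hn.
- apply: (@small_casesP 10 5 4 1 8 1 [:: (12, 31); (16, 41); (24, 61); (28, 71); (40, 101);
    (52, 131); (59, 151)]%N n _ nc hn _ _);
    [|by case|by case=> [|m] /andP[]].
  by vm_compute.
- apply: (@small_casesP 10 5 4 (-1) 15 1 [:: (23, 59); (31, 79); (35, 89); (43, 109);
    (55, 139); (59, 149)]%N n _ nc hn _ _);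
    [|by case|by case=> [|m] /andP[]].
  by vm_compute.
- apply: (@small_casesP 10 5 4 2 10 1 [:: (15, 37); (19, 47); (27, 67); (39, 97); (43, 107);
    (51, 127); (55, 137); (59, 157)]%N n _ nc hn _ _);
    [|by case|by case=> [|m] /andP[]].
  by vm_compute.
apply: (@small_casesP 10 5 4 (-2) 5 1 [:: (5, 13); (9, 23); (17, 43); (21, 53); (29, 73);
  (33, 83); (41, 103); (45, 113); (59, 163)]%N n _ nc hn _ _);
    [|by case|by case=> [|m] /andP[]].
by vm_compute.
Qed.

(** * Translation into least primes and least moduli *)

Lemma modulus_prime_least al d c r n p (f : nat -> int) (b : rat) :
  is_modulus_prime al d c r n p ->
  (forall k, f k = al%:Z * k%:Z * (d%:Z * k%:Z - r)) ->
  (0 < c)%N -> b = ((2 * d * n)%N%:R - r%:~R) / c%:R ->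
  is_least_prime r d b p /\ is_least_modulus f n p.
Proof.
case=> [[pp pr hp] pmin nc hc] fE c0 ->; split.
  apply: (is_least_primeP (N := (2 * d * n)%N%:Z - r) (c := c)) => // q.
  rewrite ler_pdivrMr ?ltr0n // -(ler_int rat) intrB intrM mulrC.
  by [].
exact: is_least_modulus_collides (prime_gt0 pp) nc hc.
Qed.

Theorem corollary1p1 :
  (forall n : nat, (6 <= n)%N ->
    (exists p : nat,
      is_least_prime 1 4 ((8 * n%:R - 1) / 3) p /\
      is_least_modulus (fun k => 4 * k%:Z * (4 * k%:Z - 1)) n p) /\
    (exists p : nat,
      is_least_prime (-1) 4 ((8 * n%:R + 1) / 3) p /\
      is_least_modulus (fun k => 4 * k%:Z * (4 * k%:Z + 1)) n p)) /\
  (forall (r : int) (n : nat),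
    r \in [:: 1; -1; 2; -2] -> (Cbound r <= n)%N ->
    exists p : nat,
      is_least_prime r 5 ((10 * n%:R - r%:~R) / 4) p /\
      is_least_modulus (fun k => 10 * k%:Z * (5 * k%:Z - r)) n p).
Proof.
split=> [n n6|r n hr Cn].
  split.
    have [p hp] := modulus_prime4 n6 (or_introl (erefl 1)).
    by exists p; apply: (modulus_prime_least hp) => //; rewrite natrM.
  have [p hp] := modulus_prime4 n6 (or_intror (erefl (-1))).
  exists p; apply: (modulus_prime_least hp) => //.
  by rewrite natrM intrN opprK.
have [p hp] := modulus_prime5 hr Cn.
by exists p; apply: (modulus_prime_least hp) => //; rewrite natrM.
Qed.
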